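(* Let $K\subset\mathbb{R}^N$ be a $C^2_+$-regular convex body that is symmetric with respect to the origin, and let $\Omega\subset\mathbb{R}^N$ be a bounded convex body. Then $$\frac{T^K(\Omega)}{|\Omega|}\ \le\ \frac13\,(R_\Omega^K)^2 .$$
   Context: A convex body is a compact convex subset of $\mathbb{R}^N$ with nonempty interior. A convex body $K$ is $C^2_+$-regular if its boundary can be written locally as the graph of a $C^2$ function with positive definite Hessian. The support function of $K$ is $h_K(x)=\max\{x\cdot y : y\in K\}$; when $K$ is symmetric with respect to the origin, $h_K$ is a norm. The $K$-torsional rigidity of $\Omega$ is $$T^K(\Omega)=\max_{u\in W_0^{1,2}(\Omega)\setminus\{0\}}\frac{\left(\int_\Omega u\,dx\right)^2}{\int_\Omega h_K^2(\nabla u)\,dx},$$ where, for a convex body $\Omega$, $W_0^{1,2}(\Omega)$ is the Sobolev space $W^{1,2}_0$ of the interior of $\Omega$. $|\Omega|$ is Lebesgue measure. The anisotropic inradius $R_\Omega^K$ is the largest $t$ such that $x+tK\subseteq\Omega$ for some $x\in\Omega$. *)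

(* Defs.v *)
From HB Require Import structures.
From mathcomp Require Import all_boot all_order all_algebra.
From mathcomp Require Import all_classical all_reals all_analysis.

Set Implicit Arguments.
Unset Strict Implicit.
Unset Printing Implicit Defensive.
Import Order.TTheory GRing.Theory Num.Theory.
Import numFieldNormedType.Exports.

Local Open Scope classical_set_scope.
Local Open Scope ring_scope.

(* The sigma-algebra on R^n is the product one (generated by the coordinates),
   as the library does for n.-tuple; it is the Borel sigma-algebra. *)
Definition rV_display : measure_display -> measure_display.
Proof. exact. Qed.

Section rV_measurable.
Context {R : realType} (n : nat).

Definition rV_coord (i : 'I_n) (x : 'rV[R]_n) : R := x 0 i.

Let rV_set0 : g_sigma_preimage rV_coord set0.
Proof. exact: sigma_algebra0. Qed.

Let rV_setC A : g_sigma_preimage rV_coord A -> g_sigma_preimage rV_coord (~` A).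
Proof. exact: sigma_algebraC. Qed.

Let rV_bigcup (F : (set 'rV[R]_n)^nat) :
  (forall i, g_sigma_preimage rV_coord (F i)) ->
  g_sigma_preimage rV_coord (\bigcup_i (F i)).
Proof. exact: sigma_algebra_bigcup. Qed.

HB.instance Definition _ := @isMeasurable.Build (rV_display default_measure_display)
  'rV[R]_n (g_sigma_preimage rV_coord) rV_set0 rV_setC rV_bigcup.

End rV_measurable.

Section rV_measurable_fun.
Context {R : realType}.

Lemma measurable_rV_coord n (i : 'I_n) :
  measurable_fun [set: 'rV[R]_n] (rV_coord i).
Proof.
move=> _ Y mY; rewrite setTI; apply: sub_sigma_algebra => /=.
rewrite -bigcup_seq/=; exists i => /=; first by rewrite mem_index_enum.
by exists Y => //; rewrite setTI.
Qed.

Lemma measurable_fun_rVP d (T : measurableType d) n (f : T -> 'rV[R]_n) :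
  (forall i, measurable_fun [set: T] (fun x => f x 0 i)) ->
  measurable_fun [set: T] f.
Proof.
move=> mf.
have : g_sigma_preimage (fun i => rV_coord i \o f) `<=` measurable.
  apply: smallest_sub; first exact: sigma_algebra_measurable.
  case: n => [|n] in f mf *; first by rewrite big_ord0.
  rewrite -bigcup_mkord_ord; apply: bigcup_sub => i Ii.
  by move=> A [B mB <-]; exact: mf.
rewrite g_sigma_preimage_comp => prefS _ A mA.
by apply: prefS; exists A.
Qed.

Definition cons_rV n (p : R * 'rV[R]_n) : 'rV[R]_n.+1 := row_mx p.1%:M p.2.

Lemma cons_rV0 n (p : R * 'rV[R]_n) : cons_rV p 0 ord0 = p.1.
Proof.
have -> : ord0 = lshift n (ord0 : 'I_1) :> 'I_(1 + n) by exact: val_inj.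
by rewrite [LHS](@row_mxEl _ _ 1 n) mxE eqxx.
Qed.

Lemma cons_rVS n (p : R * 'rV[R]_n) (j : 'I_n) :
  cons_rV p 0 (lift ord0 j) = p.2 0 j.
Proof.
have -> : lift ord0 j = rshift 1 j by exact: val_inj.
by rewrite [LHS](@row_mxEr _ _ 1 n).
Qed.

Lemma measurable_cons_rV n :
  measurable_fun [set: measurableTypeR R * 'rV[R]_n] (@cons_rV n).
Proof.
apply: measurable_fun_rVP => i; case: (unliftP ord0 i) => [j|] ->.
  under eq_fun do rewrite cons_rVS.
  exact: (measurableT_comp (@measurable_rV_coord n j) measurable_snd).
by under eq_fun do rewrite cons_rV0; exact: measurable_fst.
Qed.

Definition uncons_rV n (x : 'rV[R]_n.+1) : R * 'rV[R]_n :=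
  (x 0 ord0, \row_j x 0 (lift ord0 j)).

Lemma measurable_uncons_rV n :
  measurable_fun [set: 'rV[R]_n.+1]
    (@uncons_rV n : _ -> measurableTypeR R * 'rV[R]_n).
Proof.
apply: measurable_fun_pair; first exact: measurable_rV_coord.
apply: measurable_fun_rVP => i.
by under eq_fun do rewrite mxE; exact: measurable_rV_coord.
Qed.

Lemma cons_rVK n : cancel (@cons_rV n) (@uncons_rV n).
Proof.
move=> [a x]; rewrite /uncons_rV cons_rV0; congr pair.
by apply/rowP => j; rewrite mxE cons_rVS.
Qed.

End rV_measurable_fun.

Section cons_measure.
Context {R : realType} (n : nat).
Variable m : {sigma_finite_measure set 'rV[R]_n -> \bar R}.

Definition cons_measure : set 'rV[R]_n.+1 -> \bar R :=
  pushforward (@lebesgue_measure R \x m)%E (@cons_rV R n).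

Let cons_measure0 : cons_measure set0 = 0%E.
Proof. by rewrite /cons_measure /pushforward preimage_set0 measure0. Qed.

Let cons_measure_ge0 A : (0 <= cons_measure A)%E.
Proof. by rewrite /cons_measure /pushforward measure_ge0. Qed.

Let cons_measure_additive : semi_sigma_additive cons_measure.
Proof.
have mf := @measurable_cons_rV R n.
move=> F mF tF mUF; rewrite /cons_measure /pushforward preimage_bigcup.
apply: measure_semi_sigma_additive.
- by move=> k; rewrite -[X in measurable X]setTI; exact: mf.
- apply/trivIsetP => /= i j _ _ ij; rewrite -preimage_setI.
  by move/trivIsetP : tF => /(_ _ _ _ _ ij) ->//; rewrite preimage_set0.
- by rewrite -preimage_bigcup -[X in measurable X]setTI; exact: mf.
Qed.

HB.instance Definition _ := isMeasure.Build _ _ _ cons_measure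
  cons_measure0 cons_measure_ge0 cons_measure_additive.

Let cons_measure_sigma_finite : sigma_finite setT cons_measure.
Proof.
have /sigma_finiteP[F [TF ndF Foo]] := sigma_finiteT (@lebesgue_measure R).
have /sigma_finiteP[G [TG ndG Goo]] := sigma_finiteT m.
exists (fun k => @uncons_rV R n @^-1` (F k `*` G k)).
  rewrite -preimage_bigcup -[LHS](preimage_setT (@uncons_rV R n)).
  congr (_ @^-1` _); rewrite -setXTT TF TG predeqE => -[x y]; split.
    move=> [/= [i _ Fix] [j _ Gjy]]; exists (maxn i j) => //; split.
    - by move: x Fix; exact/subsetPset/ndF/leq_maxl.
    - by move: y Gjy; exact/subsetPset/ndG/leq_maxr.
  by move=> [i _ []/= ? ?]; split; exists i.
move=> k; have [mF Fk] := Foo k; have [mG Gk] := Goo k; split.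
  rewrite -[X in measurable X]setTI; apply: measurable_uncons_rV => //.
  exact: measurableX.
rewrite /cons_measure /pushforward -comp_preimage.
rewrite (_ : _ \o _ = id); last by apply/funext => x; exact: cons_rVK.
by rewrite preimage_id product_measure1E// lte_mul_pinfty// ge0_fin_numE.
Qed.

HB.instance Definition _ := Measure_isSigmaFinite.Build _ _ _ cons_measure
  cons_measure_sigma_finite.

End cons_measure.

(* n-dimensional Lebesgue measure: the Dirac mass on R^0, then the image of
   lebesgue_measure \x (n-dimensional Lebesgue measure) under cons_rV. *)
Fixpoint lebesgue_rV {R : realType} n :
    {sigma_finite_measure set 'rV[R]_n -> \bar R} :=
  match n with
  | 0 => \d_(0 : 'rV[R]_0)
  | n.+1 => cons_measure (lebesgue_rV n)
  end.

Section calculus.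
Context {R : realType} (n : nat).
Implicit Types (f : 'rV[R]_n -> R) (D : set 'rV[R]_n).

Definition partial (i : 'I_n) f : 'rV[R]_n -> R := 'D_(delta_mx 0 i) f.

(* meaningful for open D *)
Fixpoint Ck (k : nat) D f : Prop :=
  (forall x, D x -> {for x, continuous f}) /\
  (if k is k'.+1 then forall i : 'I_n,
     (forall x, D x -> derivable f x (delta_mx 0 i)) /\ Ck k' D (partial i f)
   else True).

Definition hessian f (x : 'rV[R]_n) : 'M[R]_n :=
  \matrix_(i, j) partial i (partial j f) x.

Definition positive_definite (A : 'M[R]_n) : Prop :=
  A^T = A /\ forall v : 'rV[R]_n, v != 0 -> 0 < (v *m A *m v^T) 0 0.

Definition test_function (O : set 'rV[R]_n) f : Prop :=
  [/\ forall k, Ck k setT f,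
      compact (closure [set x | f x != 0]) &
      closure [set x | f x != 0] `<=` O].

End calculus.

Section convex_bodies.
Context {R : realType} (n : nat).

Definition convex_body (K : set 'rV[R]_n) : Prop :=
  [/\ compact K, convex_set (K : set (convex_lmodType 'rV[R]_n)) & K° !=set0].

Definition origin_symmetric (K : set 'rV[R]_n) : Prop :=
  forall x, K x -> K (- x).

Definition dot (x y : 'rV[R]_n) : R := \sum_i x 0 i * y 0 i.

Definition support_function (K : set 'rV[R]_n) (x : 'rV[R]_n) : R :=
  sup [set dot x y | y in K].

Definition boundary (K : set 'rV[R]_n) : set 'rV[R]_n := closure K `\` K°.

Definition inradius (K Omega : set 'rV[R]_n) : R :=
  sup [set t | exists2 x, Omega x & [set x + t *: y | y in K] `<=` Omega].

End convex_bodies.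

(* Near each boundary point, up to an orthogonal change of coordinates Q, the
   boundary is the graph of f, the graph direction being coordinate 0. *)
Definition C2plus_regular {R : realType} n (K : set 'rV[R]_n.+1) : Prop :=
  forall x, boundary K x ->
  exists (Q : 'M[R]_n.+1) (V : set 'rV[R]_n.+1) (D : set 'rV[R]_n)
         (f : 'rV[R]_n -> R),
  [/\ Q *m Q^T = 1%:M, open_nbhs x V, open D, Ck 2 D f &
      (forall y, D y -> positive_definite (hessian f y)) /\
      boundary K `&` V = [set cons_rV (f y, y) *m Q | y in D] `&` V].

Section sobolev.
Context {R : realType} (n : nat) (O : set 'rV[R]_n).
Local Notation mu := (@lebesgue_rV R n).

Definition L2 (u : 'rV[R]_n -> R) : Prop := u \_ O \in Lfun mu 2%:E.

Definition L2_cvg (us : ('rV[R]_n -> R)^nat) (u : 'rV[R]_n -> R) : Prop :=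
  'N[mu]_2%:E[EFin \o ((us k \- u) \_ O)%R]%E @[k --> \oo] --> 0%E.

Definition weak_gradient (u : 'rV[R]_n -> R) (g : 'rV[R]_n -> 'rV[R]_n) : Prop :=
  forall (phi : 'rV[R]_n -> R) (i : 'I_n), test_function O phi ->
  \int[mu]_(x in O) (u x * partial i phi x) =
  - \int[mu]_(x in O) (g x 0 i * phi x).

(* The weak gradient is only determined a.e., so membership in W^{1,2}(O) is a
   relation between u and a representative g of its gradient. *)
Definition W12 (u : 'rV[R]_n -> R) (g : 'rV[R]_n -> 'rV[R]_n) : Prop :=
  [/\ L2 u, forall i, L2 (fun x => g x 0 i) & weak_gradient u g].

(* W^{1,2}_0(O) is the closure of the test functions for the W^{1,2} norm, whose
   convergence is L2 convergence of the functions and of each partial. *)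
Definition W12_0 (u : 'rV[R]_n -> R) (g : 'rV[R]_n -> 'rV[R]_n) : Prop :=
  W12 u g /\
  exists phi : ('rV[R]_n -> R)^nat,
    [/\ forall k, test_function O (phi k), L2_cvg phi u &
        forall i, L2_cvg (fun k => partial i (phi k)) (fun x => g x 0 i)].

End sobolev.

(* The maximum is rendered as a supremum in \bar R, so that an unbounded set of
   quotients would give +oo.  An element u of the Sobolev space is nonzero when
   it is not a.e. 0. *)
Definition torsional_rigidity {R : realType} n (K Omega : set 'rV[R]_n) : \bar R :=
  let mu := @lebesgue_rV R n in
  let O := Omega° in
  ereal_sup [set q | exists u g,
    [/\ W12_0 O u g, ~ {ae mu, forall x, O x -> u x = 0} &
        q = ((\int[mu]_(x in O) (u x)%:E) ^+ 2 /
             \int[mu]_(x in O) (support_function K (g x) ^+ 2)%:E)%E]].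

(* Main.v *)
Require Import Defs.
From mathcomp Require Import all_boot all_order all_algebra.
From mathcomp Require Import all_classical all_reals all_analysis.
From mathcomp Require Import measurable_realfun lra ring.
Import Order.TTheory GRing.Theory Num.Theory.
Import numFieldNormedType.Exports.
Set Implicit Arguments.
Unset Strict Implicit.
Unset Printing Implicit Defensive.
Local Open Scope classical_set_scope.
Local Open Scope ring_scope.

(* Fix a test function f and a polytope P, cut out by finitely many half-spaces
   a_i.x <= b_i, with supp f in the interior of P and P inside the interior of
   Omega. Let d_i(x) = (b_i - a_i.x) / h_K(a_i) be the K-distance to the i-th face
   and split P into the pieces A_i on which the i-th face is the nearest one. On
   A_i one has d_i <= R, and the flow in a direction v_i of K with
   a_i.v_i = h_K(a_i) stays in A_i until it hits the face, where f = 0. With l(x)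
   the length of the part of this flow line lying upstream of x in A_i, Tonelli gives
   int_{A_i} |f| <= int_{A_i} l h_K(grad f)  and  int l^2 = int d_i^2 = 2 int l d_i,
   and l + d_i <= R, so 3 int_{A_i} l^2 <= R^2 |A_i|. Young's inequality, summation
   over i, passage to the limit in W^{1,2}_0 and optimisation of the Young
   parameter c yield the bound. *)

(** A polytope serves because the flow direction is constant on each [A_i]: translation invariance
    of Lebesgue measure does the work of a coarea formula, with no Jacobian. Dividing by [h_K(a_i)]
    makes every [d_j] drop at speed at most 1 along directions of [K], and [d_i] at speed exactly 1
    along [v_i]. Hence the i-th face stays the nearest one along the flow, and [x + d_i(x) K] stays
    in P, which is why [d_i <= R]. At the upstream end of a flow line the distance is [d_i + l],
    whence [l + d_i <= R]. The two relations for the integral of [d_i^2] come from one exchange of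
    integrals, applied to the weights [2s] and [2 d_i]. Young's inequality with one [c] for all
    pieces replaces Cauchy-Schwarz: it is additive, so it sums over the pieces and survives limits
    without square roots.

    The constant 1/3 is exact for [K = [-1,1]] and [Omega = [-R,R]], where [l + d_i = R] everywhere
    and the quotient is [(2R^3/3) / (2R)]. *)

Section rV_norm.
Context {R : realType} {n : nat}.
Implicit Types x y v : 'rV[R]_n.

Lemma coord_le_norm x i : `|x 0 i| <= `|x|.
Proof.
rewrite [leRHS]mx_normrE.
exact: (le_bigmax_cond _ (fun k => `|x k.1 k.2|) (j := (0, i)) isT).
Qed.

Lemma rV_norm_le x (e : R) : 0 <= e -> (forall i, `|x 0 i| <= e) -> `|x| <= e.
Proof.
move=> e0 xe; rewrite [leLHS]mx_normrE; apply/bigmax_leP; split => // -[a i] _ /=.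
by rewrite (ord1 a).
Qed.

Lemma rV_norm_lt x (e : R) : 0 < e -> (forall i, `|x 0 i| < e) -> `|x| < e.
Proof.
move=> e0 xe; rewrite [ltLHS]mx_normrE; apply/bigmax_ltP; split => // -[a i] _ /=.
by rewrite (ord1 a).
Qed.

End rV_norm.

(** * Lebesgue measure on row vectors: open sets, translations, Tonelli along a direction *)

Section rV_lebesgue.
Context {R : realType}.

(** The sigma-algebra is generated by the coordinates, so an open set is reached as the union of the
    boxes with rational corners that it contains. Boxes that leave [U] are replaced by [set0], which
    lets the union range over a whole countable type. *)
Lemma open_measurable_rV n (U : set 'rV[R]_n) : open U -> measurable U.
Proof.
move=> oU.
pose box (p : 'rV[rat]_n * 'rV[rat]_n) : set 'rV[R]_n :=
  [set x | forall i, x 0 i \in `]ratr (p.1 0 i), ratr (p.2 0 i)[].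
have mbox p : measurable (box p).
  have -> : box p = \bigcap_(i in [set: 'I_n])
      (rV_coord i @^-1` `]ratr (p.1 0 i), ratr (p.2 0 i)[%classic).
    by apply/seteqP; split=> x /=; [move=> bx i _; exact: bx|move=> bx i; exact: bx].
  apply: fin_bigcap_measurable => // i _; rewrite -[X in measurable X]setTI.
  exact: measurable_rV_coord.
have -> : U = \bigcup_p (if `[< box p `<=` U >] then box p else set0).
  apply/seteqP; split=> [x Ux|x [p _]]; last by case: asboolP => // + bx; apply.
  have /nbhs_ballP[e /= e0 xeU] : nbhs x U by exact: open_nbhs_nbhs.
  have lo i : {q : rat | ratr q \in `]x 0 i - e, x 0 i[}.
    by apply/cid/rat_in_itvoo; rewrite gtrBl.
  have hi i : {q : rat | ratr q \in `]x 0 i, x 0 i + e[}.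
    by apply/cid/rat_in_itvoo; rewrite ltrDl.
  exists (\row_i sval (lo i), \row_i sval (hi i)) => //.
  rewrite asboolT; first by move=> i; rewrite !mxE /= in_itv/=;
    have := svalP (lo i); have := svalP (hi i); rewrite !in_itv/= => /andP[-> _] /andP[_ ->].
  move=> y by_; apply: xeU; rewrite mx_norm_ball /ball_ /=.
  apply: rV_norm_lt => // i; rewrite !mxE.
  have := by_ i; rewrite /= !mxE !in_itv/=.
  have := svalP (lo i); have := svalP (hi i); rewrite !in_itv/=.
  move=> /andP[h1 h2] /andP[h3 h4] /andP[h5 h6].
  by rewrite ltr_norml; apply/andP; split; lra.
apply: countable_bigcupT_measurable => [|p]; first exact: countableP.
by case: ifP.
Qed.

Lemma closed_measurable_rV n (F : set 'rV[R]_n) : closed F -> measurable F.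
Proof.
move=> cF; rewrite -[F]setCK; apply: measurableC; apply: open_measurable_rV.
exact: closed_openC.
Qed.

Lemma continuous_measurable_rV n (f : 'rV[R]_n -> R) :
  continuous f -> measurable_fun [set: 'rV[R]_n] f.
Proof.
move=> cf; apply: (measurability _ (RGenOpens.measurableE R)).
move=> _ [_ [a [b [-> <-]]]]; rewrite setTI; apply: open_measurable_rV.
exact: open_comp.
Qed.

Lemma measurable_rV_addr n (v : 'rV[R]_n) :
  measurable_fun [set: 'rV[R]_n] (fun x => x + v).
Proof.
apply: measurable_fun_rVP => i; under eq_fun do rewrite mxE.
by apply: measurable_funD; [exact: measurable_rV_coord|exact: measurable_cst].
Qed.

Lemma lebesgue_measure_addr (a : R) (A : set R) : measurable A ->
  pushforward (@lebesgue_measure R)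
    ((fun x => x + a) : measurableTypeR R -> measurableTypeR R) A
  = lebesgue_measure A.
Proof.
move=> mA; apply/esym.
pose t : measurableTypeR R -> measurableTypeR R := fun x => x + a.
have mt : measurable_fun setT t by exact: measurable_funD.
apply: (@lebesgue_measure_unique R (pushforward lebesgue_measure t)) => //=.
move=> _ [[b c]] _ <-.
have -> : pushforward lebesgue_measure t `]b, c]%classic =
    lebesgue_measure `]b - a, c - a]%classic.
  rewrite /pushforward; congr (lebesgue_measure _).
  by apply/seteqP; split => x /=; rewrite !in_itv/= ltrBlDr lerBrDr.
rewrite !lebesgue_measure_itv/= !lte_fin ltrD2r.
by rewrite -!EFinB opprB addrA addrNK.
Qed.

Lemma ge0_integral_addr (a : R) (f : R -> \bar R) :
  measurable_fun [set: R] f -> (forall x, (0 <= f x)%E) ->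
  (\int[lebesgue_measure]_x f (x + a)%R = \int[lebesgue_measure]_x f x)%E.
Proof.
move=> mf f0; pose t : measurableTypeR R -> measurableTypeR R := fun x => x + a.
have mt : measurable_fun setT t by exact: measurable_funD.
rewrite -[LHS](@ge0_integral_pushforward _ _ _ _ _ _ mt lebesgue_measure setT f)//.
by apply: eq_measure_integral => A mA _; exact: lebesgue_measure_addr.
Qed.

Lemma ge0_integral_cons_rV n (f : 'rV[R]_n.+1 -> \bar R) :
  measurable_fun setT f -> (forall x, (0 <= f x)%E) ->
  (\int[lebesgue_rV n.+1]_x f x =
   \int[lebesgue_measure]_a \int[lebesgue_rV n]_x f (cons_rV (a, x)))%E.
Proof.
move=> mf f0.
rewrite [LHS](@ge0_integral_pushforward _ _ _ _ _ _ (@measurable_cons_rV R n)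
  (lebesgue_measure \x lebesgue_rV n)%E setT)//.
rewrite preimage_setT fubini_tonelli1//; first exact: (measurableT_comp mf (@measurable_cons_rV R n)).
by move=> p; exact: f0.
Qed.

(** Induction on the dimension: Tonelli splits off the first coordinate, which is translated on the
    line, and the induction hypothesis translates the remaining ones. *)
Lemma lebesgue_rV_addr n (v : 'rV[R]_n) (f : 'rV[R]_n -> \bar R) :
  measurable_fun setT f -> (forall x, (0 <= f x)%E) ->
  (\int[lebesgue_rV n]_x f (x + v)%R = \int[lebesgue_rV n]_x f x)%E.
Proof.
elim: n v f => [|n IH] v f mf f0.
  by apply: eq_integral => x _; congr f; rewrite !thinmx0.
rewrite !ge0_integral_cons_rV//; last first.
  exact: (measurableT_comp mf (@measurable_rV_addr _ v)).
pose w : 'rV[R]_n := \row_j v 0 (lift ord0 j).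
have consD a x : cons_rV (a, x) + v = cons_rV (a + v 0 ord0, x + w).
  apply/rowP => i; rewrite mxE; case: (unliftP ord0 i) => [j|] ->.
    by rewrite !cons_rVS !mxE.
  by rewrite !cons_rV0.
pose g a := (\int[lebesgue_rV n]_x f (cons_rV (a, x)))%E.
have mg : measurable_fun [set: measurableTypeR R] g.
  apply: (@measurable_fun_fubini_tonelli_F _ _ _ _ _ _
    (fun p : measurableTypeR R * 'rV[R]_n => f (cons_rV p))).
    exact: (measurableT_comp mf (@measurable_cons_rV R n)).
  by move=> p; exact: f0.
transitivity (\int[lebesgue_measure]_a g (a + v 0 ord0)%R)%E.
  apply: eq_integral => a _; rewrite /g -[RHS](IH w).
  - by apply: eq_integral => x _; rewrite consD.
  - apply: (measurableT_comp mf).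
    apply: (measurableT_comp (@measurable_cons_rV R n)).
    exact: measurable_fun_pair.
  - by move=> x.
by rewrite ge0_integral_addr// => a; apply: integral_ge0.
Qed.

Lemma measurable_flow n (v : 'rV[R]_n) :
  measurable_fun [set: 'rV[R]_n * measurableTypeR R] (fun p => p.1 + p.2 *: v).
Proof.
apply: measurable_fun_rVP => i; under eq_fun do rewrite !mxE.
apply: measurable_funD.
  exact: (measurableT_comp (@measurable_rV_coord R n i) measurable_fst).
by apply: measurable_funM => //; exact: measurable_snd.
Qed.

(* Fubini, after which the translation by [s *: v] is removed for each fixed [s]. *)
Lemma tonelli_flow n (v : 'rV[R]_n) (F : 'rV[R]_n * measurableTypeR R -> \bar R) :
  measurable_fun setT F -> (forall p, (0 <= F p)%E) ->
  (\int[lebesgue_rV n]_y \int[lebesgue_measure]_s F (y, s) =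
   \int[lebesgue_rV n]_x \int[lebesgue_measure]_s F (x - s *: v, s)%R)%E.
Proof.
move=> mF F0; rewrite fubini_tonelli//.
rewrite [RHS](@fubini_tonelli _ _ _ _ _ _ _
  (fun p : 'rV[R]_n * measurableTypeR R => F (p.1 - p.2 *: v, p.2)))//.
  apply: eq_integral => s _.
  rewrite -(@lebesgue_rV_addr _ (- (s *: v)))//.
  apply: (measurableT_comp mF); exact: measurable_fun_pair.
apply: (measurableT_comp mF); apply: measurable_fun_pair => //=.
by under eq_fun do rewrite -scalerN; exact: measurable_flow.
Qed.

End rV_lebesgue.

Lemma measurable_patch {R : realType} d (T : measurableType d) (E : set T)
    (w : T -> \bar R) :
  measurable E -> measurable_fun setT w -> measurable_fun setT (w \_ E).
Proof.
move=> mE mw; apply: (iffLR (measurable_restrictT w mE)); exact: measurable_funTS.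
Qed.

(** * One-dimensional integrals along a flow line *)

Section interval_integrals.
Context {R : realType}.
Local Notation leb := lebesgue_measure.

Lemma integral_affine (a b c : R) : 0 <= c ->
  (\int[leb]_(s in `[0%R, c]) (a + b * s)%:E = (a * c + b * c ^+ 2 / 2)%:E)%E.
Proof.
rewrite le_eqVlt => /predU1P[<-|c0].
  rewrite set_itv1 integral_set1 expr0n/=; congr (_%:E); lra.
pose F : R -> R := a \*: (id : R -> R) + (b / 2) \*: (id : R -> R) ^+ 2.
have FE u : F u = a * u + b / 2 * u ^+ 2 by rewrite /F !fctE.
have dF (s : R) : is_derive s (1 : R) F (a + b * s).
  apply: (@is_derive_eq _ _ _ _ _ _ _ _
    (is_deriveD (is_deriveZ a (is_derive_id s (1 : R)))
    (is_deriveZ (b / 2) (is_deriveX 2 (is_derive_id s (1 : R)))))).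
  by rewrite /GRing.scale/= expr1 !mulr1 mulrA divfK.
have cF : continuous F.
  by move=> u; apply: differentiable_continuous; apply/derivable1_diffP.
rewrite (@continuous_FTC2 _ (fun s => a + b * s) F _ _ c0)//.
- by rewrite !FE -EFinB; congr (_%:E); rewrite expr0n/=; field.
- apply: continuous_subspaceT => s; apply: cvgD; first exact: cvg_cst.
  by apply: cvgMr; exact: cvg_id.
- by split=> [s _|//|//]; [exact: ex_derive|apply: cvg_at_right_filter; exact: cF|
    apply: cvg_at_left_filter; exact: cF].
- by move=> s _; rewrite derive1E; exact: derive_val.
Qed.

(** With [m = sup S], such an [S] lies between [[0, m[] and [[0, m]]: its measure is at most [m],
    and the integral is at least that of [2s] over [[0, m[], namely [m^2]. It is applied to the
    times at which a flow line upstream of a point lies in the piece. *)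
Lemma itv_sqr_le_integral (S : set R) : measurable S -> S 0 ->
  (forall s t, 0 <= s <= t -> S t -> S s) -> (forall s, S s -> 0 <= s) ->
  has_ubound S ->
  (leb S ^+ 2 <= \int[leb]_(s in S) (2 * s)%:E)%E.
Proof.
move=> mS S0 downS S_ge0 ubS; pose m := sup S.
have m0 : 0 <= m by apply: ub_le_sup.
have SleM : (leb S <= m%:E)%E.
  apply: (@le_trans _ _ (leb `[0, m]%classic)).
    apply: le_measure; rewrite ?inE// => s Ss /=.
    by rewrite in_itv/= S_ge0//= ub_le_sup.
  rewrite lebesgue_measure_itv/= lte_fin; case: ifPn => [_|]; first by rewrite -EFinB subr0.
  by rewrite lee_fin.
apply: (@le_trans _ _ (m ^+ 2)%:E).
  rewrite EFin_expe.
  have lS0 : (0 <= leb S)%E by exact: measure_ge0.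
  by rewrite !expe2; exact: lee_pmul.
have -> : (m ^+ 2)%:E = (\int[leb]_(s in `[0%R, m]) (2 * s)%:E)%E.
  under eq_integral do rewrite -[(2 * _)%R]add0r.
  by rewrite integral_affine// mul0r add0r; congr (_%:E); field.
rewrite -integral_itv_bndo_bndc//; last exact/measurable_EFinP/measurable_funM.
apply: ge0_subset_integral => //=.
- exact/measurable_EFinP/measurable_funM.
- by move=> s Ss; rewrite lee_fin mulr_ge0// S_ge0.
move=> s /=; rewrite in_itv/= => /andP[s0 sm].
have [t St st] := sup_gt (ex_intro _ 0 S0) sm.
by apply: (downS _ t) => //; rewrite s0 ltW.
Qed.

End interval_integrals.

(** * Transport along a constant direction inside one piece *)

Section flow.
Context {R : realType} {n : nat}.
Variables (A : set 'rV[R]_n) (v : 'rV[R]_n) (d : 'rV[R]_n -> R) (r : R).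
Hypotheses (mA : measurable A) (md : measurable_fun setT d)
  (d_flow : forall x s, d (x + s *: v) = d x - s)
  (d_itv : forall x, A x -> 0 <= d x <= r)
  (A_flow : forall x s, A x -> 0 <= s <= d x -> A (x + s *: v)).
Local Notation mu := (@lebesgue_rV R n).
Local Notation leb := lebesgue_measure.

(** [fwd] pairs a starting point with a travel time up to its exit; [bwd] pairs an arrival point
    with a travel time whose starting point lies in [A]. The shear along [v] exchanges the two
    sets. *)
Let fwd : set ('rV[R]_n * measurableTypeR R) :=
  [set p | A p.1 /\ 0 <= p.2 <= d p.1].
Let bwd : set ('rV[R]_n * measurableTypeR R) :=
  [set p | [/\ A p.1, 0 <= p.2 & A (p.1 - p.2 *: v)]].

Let d_flowB x s : d (x - s *: v) = d x + s.
Proof. by rewrite -scaleNr d_flow opprK. Qed.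

Let fwd_flow x s : fwd (x - s *: v, s) <-> bwd (x, s).
Proof.
split=> [[/= Axs /andP[s0 sd]]|[/= Ax s0 Axs]].
  by split=> //=; rewrite -(subrK (s *: v) x); apply: A_flow => //; rewrite s0.
by split=> //=; rewrite s0/= d_flowB lerDr; have /andP[] := d_itv Ax.
Qed.

Let measurable_fwd : measurable fwd.
Proof.
have -> : fwd = (A `*` setT) `&` (snd @^-1` `[0, +oo[%classic) `&`
    ((fun p => d p.1 - p.2) @^-1` `[0, +oo[%classic).
  apply/seteqP; split=> -[x s] /=; rewrite !in_itv/= !andbT subr_ge0.
    by move=> [Ax /andP[]].
  by move=> [[[Ax _] s0] sd]; split=> //; rewrite s0.
apply: measurableI; first apply: measurableI.
- exact: measurableX.
- by rewrite -[X in measurable X]setTI; exact: measurable_snd.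
- rewrite -[X in measurable X]setTI; apply: measurable_funB => //.

  exact: (measurableT_comp md measurable_fst).
Qed.

Let measurable_bwd : measurable bwd.
Proof.
have -> : bwd = (A `*` setT) `&` (snd @^-1` `[0, +oo[%classic) `&`
    ((fun p => p.1 + p.2 *: - v) @^-1` A).
  apply/seteqP; split=> -[x s] /=; rewrite !in_itv/= !andbT scalerN.
    by move=> [].
  by move=> [[[]]].
apply: measurableI; first apply: measurableI.
- exact: measurableX.
- by rewrite -[X in measurable X]setTI; exact: measurable_snd.
- by rewrite -[X in measurable X]setTI; exact: measurable_flow.
Qed.

Let restrict_xsection (E : set ('rV[R]_n * measurableTypeR R)) w x :
  (\int[leb]_s (w \_ E) (x, s) = \int[leb]_(s in xsection E x) w (x, s) :> \bar R)%E.
Proof.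
rewrite [RHS]integral_mkcond; apply: eq_integral => s _.
by rewrite /patch mem_xsection.
Qed.

(** The weight is evaluated at the arrival point, so exchanging the integrals and undoing the
    translation leaves a weight at [x], integrated over the times that can have led to [x]. It must
    be nonnegative on the whole product, which explains the absolute values in the weights used
    below. *)
Let flow_tonelli (w : 'rV[R]_n * measurableTypeR R -> \bar R) :
  measurable_fun setT w -> (forall p, (0 <= w p)%E) ->
  (\int[mu]_(y in A) \int[leb]_(s in `[0%R, d y]) w (y + s *: v, s)%R =
   \int[mu]_(x in A) \int[leb]_(s in xsection bwd x) w (x, s))%E.
Proof.
move=> mw w0; pose w' (p : 'rV[R]_n * measurableTypeR R) := w (p.1 + p.2 *: v, p.2).
have mw' : measurable_fun setT w'.
  apply: (measurableT_comp mw); apply: measurable_fun_pair => /=.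
    exact: measurable_flow.
  exact: measurable_snd.
transitivity (\int[mu]_y \int[leb]_s (w' \_ fwd) (y, s))%E.
  rewrite integral_mkcond; apply: eq_integral => y _.
  rewrite restrict_xsection /patch; case: ifPn => [|]; rewrite ?inE ?notin_setE => Ay.
    congr (integral _ _ _); apply/seteqP; split=> s; rewrite /xsection /= in_itv /= inE.
      by split.
    by move=> [].
  rewrite (_ : xsection _ _ = set0) ?integral_set0//.
  by apply/seteqP; split=> // s; rewrite /xsection/= inE => -[].
rewrite (@tonelli_flow _ _ v); last 2 first.
- exact: measurable_patch.
- by move=> p; apply: erestrict_ge0 => *; exact: w0.
rewrite [RHS]integral_mkcond; apply: eq_integral => x _.
transitivity (\int[leb]_s (w \_ bwd) (x, s))%E.
  apply: eq_integral => s _; rewrite /patch.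
  suff -> : ((x - s *: v, s) \in fwd) = ((x, s) \in bwd) by rewrite /w'/= subrK.
  by apply/idP/idP; rewrite !inE; apply fwd_flow.
rewrite restrict_xsection /patch; case: ifPn => [//|]; rewrite notin_setE => Ax.
rewrite (_ : xsection _ _ = set0) ?integral_set0//.
by apply/seteqP; split=> // s; rewrite /xsection/= inE => -[].
Qed.

Let l x := leb (xsection bwd x).

Let ml : measurable_fun setT l.
Proof. exact: measurable_fun_xsection. Qed.

Let l_ge0 x : (0 <= l x)%E. Proof. exact: measure_ge0. Qed.

Let msec x : measurable (xsection bwd x).
Proof. exact: measurable_xsection. Qed.

(** Going upstream for a time [s] raises [d] to [d x + s], which is still at most [r] in [A]. *)
Let section_le x s : A x -> xsection bwd x s -> 0 <= s <= r - d x.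
Proof.
move=> Ax; rewrite /xsection/= inE => -[/= _ s0 /d_itv].
by rewrite s0 d_flowB lerBrDl => /andP[].
Qed.

Let l_le x : A x -> (l x <= (r - d x)%:E)%E.
Proof.
move=> Ax; apply: (@le_trans _ _ (leb `[0, r - d x]%classic)).
  by apply: le_measure; rewrite ?inE// => s; exact: section_le.
rewrite lebesgue_measure_itv/= lte_fin; case: ifPn => [_|]; first by rewrite -EFinB subr0.
by rewrite lee_fin subr_ge0; have /andP[] := d_itv Ax.
Qed.

Let d_ge0 x : A x -> 0 <= d x.
Proof. by move=> /d_itv /andP[]. Qed.

(** Write [d y ^+ 2] as the integral of [2s] over [[0, d y]]. Seen from the arrival point [x], this
    weight is integrated over the upstream times, which gives at least [l x ^+ 2]. *)
Let integral_sqr_l :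
  (\int[mu]_(x in A) l x ^+ 2 <= \int[mu]_(x in A) (d x ^+ 2)%:E)%E.
Proof.
have -> : (\int[mu]_(y in A) (d y ^+ 2)%:E =
    \int[mu]_(y in A) \int[leb]_(s in `[0%R, d y]) (2 * `|s|)%:E)%E.
  apply: eq_integral => y; rewrite inE => Ay.
  transitivity (\int[leb]_(s in `[0%R, d y]) (0 + 2 * s)%:E)%E.
    by rewrite integral_affine ?d_ge0//; congr (_%:E); field.
  apply: eq_integral => s; rewrite inE/= in_itv/= => /andP[s0 _].
  by rewrite add0r ger0_norm.
have mw : measurable_fun setT (fun p : 'rV[R]_n * measurableTypeR R => (2 * `|p.2|)%:E).
  apply/measurable_EFinP/measurable_funM => //.
  apply: measurableT_comp => //; exact: measurable_snd.
rewrite (flow_tonelli mw); last by move=> p; rewrite lee_fin mulr_ge0.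
apply: ge0_le_integral => //.
- by move=> x _; exact: expe_ge0.
- by under eq_fun do rewrite expe2; apply/measurable_funTS/emeasurable_funM.
- apply/measurable_funTS; under eq_fun do rewrite -(restrict_xsection bwd (fun p => (2 * `|p.2|)%:E)).
  apply: measurable_fun_fubini_tonelli_F.
    exact: measurable_patch.
  by move=> p; apply: erestrict_ge0 => *; rewrite lee_fin mulr_ge0.
move=> x Ax.
have -> : (\int[leb]_(s in xsection bwd x) (2 * `|s|)%:E = \int[leb]_(s in xsection bwd x) (2 * s)%:E)%E.
  apply: eq_integral => s; rewrite inE => /(section_le Ax) /andP[s0 _].
  by rewrite ger0_norm.
apply: itv_sqr_le_integral => //.
- exact: msec.
- by rewrite /xsection/= inE; split; rewrite //= scale0r subr0.
- move=> s t /andP[s0 st]; rewrite /xsection/= !inE => -[/= _ t0 At]; split=> //=.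
  (* The point at upstream time [s] is reached from the one at time [t] by flowing forward for
     [t - s], so it lies in [A]. *)
  have -> : x - s *: v = x - t *: v + (t - s) *: v by rewrite scalerBl addrA subrK.
  apply: A_flow => //; rewrite subr_ge0 st/= d_flowB.
  by have := d_ge0 Ax; lra.
- by move=> s /(section_le Ax) /andP[].
- by exists (r - d x) => s /(section_le Ax) /andP[].
Qed.

(** Here [d y ^+ 2] is the integral of [2 (d y - s)], that is of [2 d] at the arrival point. That
    weight no longer depends on [s], so the inner integral over upstream times is a product with
    [l x]. *)
Let integral_sqr_d :
  (\int[mu]_(x in A) (d x ^+ 2)%:E = \int[mu]_(x in A) ((2 * d x)%:E * l x))%E.
Proof.
transitivity (\int[mu]_(y in A) \int[leb]_(s in `[0%R, d y]) (2 * `|d (y + s *: v)|)%:E)%E.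
  apply: eq_integral => y; rewrite inE => Ay.
  transitivity (\int[leb]_(s in `[0%R, d y]) (2 * d y + (- 2) * s)%:E)%E.
    by rewrite integral_affine ?d_ge0//; congr (_%:E); field.
  apply: eq_integral => s; rewrite inE/= in_itv/= => /andP[s0 sd].
  by rewrite d_flow ger0_norm ?subr_ge0//; congr (_%:E); ring.
have mw : measurable_fun setT (fun p : 'rV[R]_n * measurableTypeR R => (2 * `|d p.1|)%:E).
  apply/measurable_EFinP/measurable_funM => //.
  apply: measurableT_comp => //; exact: (measurableT_comp md measurable_fst).
rewrite (flow_tonelli mw); last by move=> p; rewrite lee_fin mulr_ge0.
apply: eq_integral => x; rewrite inE => Ax /=.
by rewrite integral_cst// ger0_norm ?d_ge0.
Qed.

Let integral_sqr_l_le : (\int[mu]_(x in A) l x ^+ 2 <= (r ^+ 2 / 3)%:E * mu A)%E.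
Proof.
have ml2 : measurable_fun A (fun x => l x ^+ 2)%E.
  by under eq_fun do rewrite expe2; apply/measurable_funTS/emeasurable_funM.
have md2 : measurable_fun A (fun x => (d x ^+ 2)%:E).
  exact/measurable_EFinP/measurable_funTS/measurable_funX.
have mdl : measurable_fun A (fun x => (2 * d x)%:E * l x)%E.
  apply: emeasurable_funM; last exact: measurable_funTS.
  exact/measurable_EFinP/measurable_funTS/measurable_funM.
have dl0 x : A x -> (0 <= (2 * d x)%:E * l x)%E.
  by move=> /d_ge0 d0; rewrite mule_ge0// lee_fin mulr_ge0.
rewrite [_ / _]mulrC EFinM -muleA lee_pdivlMl//.
(* The integrand is the expanded square of [l x + d x], and each of its three terms has an integral
   at least that of [l x ^+ 2]. *)
apply: (@le_trans _ _ (\int[mu]_(x in A) (l x ^+ 2 + (d x ^+ 2)%:E + (2 * d x)%:E * l x))%E).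
  rewrite ge0_integralD//; last 2 first.
  - by move=> x _; rewrite adde_ge0 ?expe_ge0// lee_fin sqr_ge0.
  - exact: emeasurable_funD.
  rewrite ge0_integralD//; last 2 first.
  - by move=> x _; rewrite expe_ge0.
  - by move=> x _; rewrite lee_fin sqr_ge0.
  rewrite -integral_sqr_d (_ : 3%:E = 1 + 1 + 1)%E; last by rewrite -!EFinD; congr (_%:E); lra.
  rewrite !ge0_muleDl ?adde_ge0// !mul1e.
  by apply: leeD; [apply: leeD => //|]; exact: integral_sqr_l.
rewrite -integral_cst//; apply: ge0_le_integral => //.
- by move=> x Ax; rewrite !adde_ge0 ?dl0 ?expe_ge0// lee_fin sqr_ge0.
- by do 2![apply: emeasurable_funD => //].
move=> x Ax; have := l_le Ax; have := l_ge0 x; have := d_ge0 Ax; have := d_itv Ax.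
case: (l x) => [t| |]//; rewrite !lee_fin.
by move=> /andP[_ dr] d0 t0 tr; nra.
Qed.

(** Moving to arrival points turns the hypothesis on [phi] into a bound by the integral of [G l],
    and [G l <= l^2 / (2c) + c G^2 / 2]. The coefficient [r^2 / (6c)] is [1 / (2c)] times the factor
    [r^2 / 3] found for [l^2]. *)
Lemma flow_young (phi G : 'rV[R]_n -> R) (c : R) : 0 < c ->
  measurable_fun setT phi -> measurable_fun setT G -> (forall x, 0 <= G x) ->
  (forall y, A y ->
    (`|phi y|%:E <= \int[leb]_(s in `[0%R, d y]) (G (y + s *: v))%:E)%E) ->
  (\int[mu]_(x in A) `|phi x|%:E <=
   (r ^+ 2 / (6 * c))%:E * mu A + (c / 2)%:E * \int[mu]_(x in A) (G x ^+ 2)%:E)%E.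
Proof.
move=> c0 mphi mG G0 phiG.
have mEG : measurable_fun setT (fun x => (G x)%:E) by exact/measurable_EFinP.
have mw : measurable_fun setT (fun p : 'rV[R]_n * measurableTypeR R => (G p.1)%:E).
  by apply: (measurableT_comp mEG) => //; exact: measurable_fst.
have ml2 : measurable_fun A (fun x => l x ^+ 2)%E.
  by under eq_fun do rewrite expe2; apply/measurable_funTS/emeasurable_funM.
have mG2 : measurable_fun A (fun x => (G x ^+ 2)%:E).
  exact/measurable_EFinP/measurable_funTS/measurable_funX.
apply: (@le_trans _ _ (\int[mu]_(x in A) ((G x)%:E * l x))%E).
  have -> : (\int[mu]_(x in A) ((G x)%:E * l x) =
      \int[mu]_(y in A) \int[leb]_(s in `[0%R, d y]) (G (y + s *: v))%:E)%E.
    rewrite (flow_tonelli mw); last by move=> p; rewrite lee_fin.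
    by apply: eq_integral => x _ /=; rewrite integral_cst.
  apply: ge0_le_integral => //.
  - exact/measurable_EFinP/measurable_funTS/measurableT_comp.
  - pose w (p : 'rV[R]_n * measurableTypeR R) := (G (p.1 + p.2 *: v))%:E.
    have mw' : measurable_fun setT w by exact: (measurableT_comp mEG (measurable_flow v)).
    (* For [y] in [A] the section of [fwd] is [[0, d y]]; the inner integral is therefore a partial
       integral of one function on the product, measurable by Tonelli. *)
    apply: (eq_measurable_fun (fun y => \int[leb]_s (w \_ fwd) (y, s))%E).
      move=> y; rewrite inE => Ay; rewrite restrict_xsection.
      congr (integral _ _ _); apply/seteqP; split=> s; rewrite /xsection /= in_itv /= inE.
        by move=> [].
      by split.
    apply/measurable_funTS/measurable_fun_fubini_tonelli_F.
      exact: measurable_patch.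
    by move=> p; apply: erestrict_ge0 => *; rewrite lee_fin.
apply: (@le_trans _ _
  (\int[mu]_(x in A) ((2 * c)^-1%:E * l x ^+ 2 + (c / 2)%:E * (G x ^+ 2)%:E))%E).
  apply: ge0_le_integral => //.
  - by move=> x _; rewrite mule_ge0// lee_fin.
  - by apply/measurable_funTS/emeasurable_funM.
  - by apply: emeasurable_funD; apply: measurable_funeM.
  move=> x Ax; have := l_le Ax; have := l_ge0 x.
  case: (l x) => [t| |]//; rewrite !lee_fin => t0 _.
  rewrite -subr_ge0 -expr2.
  have -> : (2 * c)^-1 * t ^+ 2 + c / 2 * G x ^+ 2 - G x * t
    = (2 * c)^-1 * (t - c * G x) ^+ 2 by field; rewrite gt_eqF.
  by rewrite mulr_ge0 ?sqr_ge0// invr_ge0 mulr_ge0// ltW.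
have c2 : (0 <= (2 * c)^-1) by rewrite invr_ge0 mulr_ge0// ltW.
have c3 : (0 <= c / 2) by rewrite mulr_ge0// ltW.
rewrite ge0_integralD//; last 4 first.
- by move=> x _; rewrite mule_ge0// expe_ge0.
- exact: measurable_funeM.
- by move=> x _; rewrite mule_ge0// lee_fin sqr_ge0.
- exact: measurable_funeM.
rewrite ge0_integralZl// ?lee_fin//; last by move=> x _; exact: expe_ge0.
rewrite ge0_integralZl// ?lee_fin//; last by move=> x _; rewrite lee_fin sqr_ge0.
apply: leeD => //.
have -> : r ^+ 2 / (6 * c) = (2 * c)^-1 * (r ^+ 2 / 3) by field; rewrite gt_eqF.
by rewrite EFinM -muleA lee_wpmul2l// lee_fin.
Qed.

End flow.

(** * The inner product on row vectors *)

Section dot_product.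
Context {R : realType} {n : nat}.
Implicit Types x y z : 'rV[R]_n.

Lemma dotC x y : dot x y = dot y x.
Proof. by apply: eq_bigr => i _; rewrite mulrC. Qed.

Lemma dotDr x y z : dot x (y + z) = dot x y + dot x z.
Proof. by rewrite -big_split; apply: eq_bigr => i _; rewrite mxE mulrDr. Qed.

Lemma dotZr x (a : R) y : dot x (a *: y) = a * dot x y.
Proof. by rewrite mulr_sumr; apply: eq_bigr => i _; rewrite mxE mulrCA. Qed.

Lemma dotNr x y : dot x (- y) = - dot x y.
Proof. by rewrite -scaleN1r dotZr mulN1r. Qed.

Lemma dotBr x y z : dot x (y - z) = dot x y - dot x z.
Proof. by rewrite dotDr dotNr. Qed.

Lemma dotDl x y z : dot (x + y) z = dot x z + dot y z.
Proof. by rewrite !(dotC _ z) dotDr. Qed.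

Lemma dotNl x y : dot (- x) y = - dot x y.
Proof. by rewrite !(dotC _ y) dotNr. Qed.

Lemma dotBl x y z : dot (x - y) z = dot x z - dot y z.
Proof. by rewrite dotDl dotNl. Qed.

Lemma dot_sqrB x y : dot (x - y) (x - y) = dot x x - 2 * dot x y + dot y y.
Proof. by rewrite dotBl !dotBr (dotC y x); ring. Qed.

Lemma dot_ge0 x : 0 <= dot x x.
Proof. by apply: sumr_ge0 => i _; exact: sqr_ge0. Qed.

Lemma dot_gt0 x : x != 0 -> 0 < dot x x.
Proof.
move=> x0; rewrite lt_neqAle dot_ge0 andbT eq_sym; apply: contra_neq x0.
move=> /eqP; rewrite psumr_eq0 => [/allP xx|i _]; last exact: sqr_ge0.
apply/rowP => i; rewrite mxE; apply/eqP; rewrite -sqrf_eq0 expr2.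
by apply: xx; rewrite mem_index_enum.
Qed.

Lemma continuous_rV_coord (i : 'I_n) : continuous (fun x : 'rV[R]_n => x 0 i).
Proof. exact: coord_continuous. Qed.

Lemma continuous_dot x : continuous (dot x).
Proof.
apply: continuous_big => [|i _ y]; first exact: add_continuous.
have cx : {for y, continuous (fun _ : 'rV[R]_n => x 0 i)} by exact: cst_continuous.
exact: (continuousM cx (@continuous_rV_coord i y)).
Qed.

Lemma continuous_dot_sqr x : continuous (fun y => dot (x - y) (x - y)).
Proof.
apply: continuous_big => [|i _ y]; first exact: add_continuous.
have cB : {for y, continuous (fun z : 'rV[R]_n => (x - z) 0 i)}.
  rewrite (_ : (fun _ => _) = (fun z => x 0 i - z 0 i)).
    have cx : {for y, continuous (fun _ : 'rV[R]_n => x 0 i)} by exact: cst_continuous.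
    exact: (continuousB cx (@continuous_rV_coord i y)).
  by apply/funext => z; rewrite !mxE.
exact: (continuousM cB cB).
Qed.

Lemma dot_norm_le x y : `|dot x y| <= (\sum_i `|x 0 i|) * `|y|.
Proof.
apply: (le_trans (ler_norm_sum _ _ _)); rewrite mulr_suml.
by apply: ler_sum => i _; rewrite normrM ler_wpM2l// coord_le_norm.
Qed.

End dot_product.

(** * Convex sets and strict separation by a hyperplane *)

Section convexity.
Context {R : realType} {n : nat}.
Implicit Types (A C D : set 'rV[R]_n) (x y : 'rV[R]_n).

Lemma convex_rV A x y (t : R) :
  convex_set (A : set (convex_lmodType 'rV[R]_n)) -> A x -> A y ->
  0 <= t <= 1 -> A (t *: x + (1 - t) *: y).
Proof.
move=> cA Ax Ay t01.
have t01' : Itv.spec (@Itv.num_sem R) (Itv.Real `[0%Z, 1%Z]) t.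
  by rewrite /Itv.num_sem /= in_itv/= num_real.
by have := cA x y (Itv.mk t01'); rewrite !inE => /(_ Ax Ay).
Qed.

Lemma compact_norm_le A : compact A -> exists2 M : R, 0 < M & forall x, A x -> `|x| <= M.
Proof.
move=> /compact_bounded[M [_ AM]]; exists (Num.max 1 (M + 1)).
  by rewrite lt_max ltr01.
by apply: AM; rewrite lt_max ltrDl ltr01 orbT.
Qed.

Lemma compact_open_thicken C (O : set 'rV[R]_n) : compact C -> open O -> C `<=` O ->
  exists2 e : R, 0 < e & forall x w, C x -> `|w| <= e -> O (x + w).
Proof.
move=> /compact_near_coveringP cC oO CO.
have : \forall e \near 0^'+, C `<=` (fun x => forall w, `|w| <= e -> O (x + w)).
  apply: (cC R (0^'+) (fun e x => forall w, `|w| <= e -> O (x + w))) => x Cx.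
  have /nbhs_ballP[r /= r0 xrO] : nbhs x O by apply: open_nbhs_nbhs; split => //; exact: CO.
  (* Half of the radius is spent on moving the point of [C], the other half on [w]. *)
  have r20 : 0 < r / 2 by rewrite divr_gt0.
  exists (ball x (r / 2), [set e | e < r / 2]).
    by split; [exact: nbhsx_ballx|exact: nbhs_right_lt].
  move=> [z e] [/= xz er] w we; apply: xrO.
  move: xz; rewrite !mx_norm_ball /ball_ /= opprD addrA => xz.
  apply: (le_lt_trans (ler_normB _ _)); rewrite [ltRHS](splitr r).
  exact: ltr_leD xz (le_trans we (ltW er)).
move=> [r /= r0 rP]; exists (r / 2); first by rewrite divr_gt0.
move=> x w Cx we; apply: (rP (r / 2)) we => //=; last by rewrite divr_gt0.
by rewrite sub0r normrN gtr0_norm ?divr_gt0// ltr_pdivrMr// ltr_pMr// ltr1n.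
Qed.

(** The normal is [a = y - p] with [p] the Euclidean nearest point of [D]. The threshold lies
    halfway between [dot a p] and [dot a y], which makes both inequalities strict. *)
Lemma separation D y : compact D ->
  convex_set (D : set (convex_lmodType 'rV[R]_n)) -> D !=set0 -> ~ D y ->
  exists a b, [/\ a != 0, forall x, D x -> dot a x < b & b < dot a y].
Proof.
move=> cD convD D0 Dy.
have [p + pmin] := EVT_min_rV D0 cD (continuous_subspaceT (@continuous_dot_sqr _ _ y)).
rewrite inE => Dp; pose a := y - p.
have a0 : a != 0 by rewrite subr_eq0; apply: contra_not_neq Dy => ->.
have aa0 := dot_gt0 a0.
have aP x : D x -> dot a (x - p) <= 0.
  move=> Dx; rewrite leNgt; apply/negP => ax0.
  set q := dot (x - p) (x - p); set c := dot a (x - p) in ax0.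
  have q0 : 0 <= q by exact: dot_ge0.
  (* Minimality of [p] against the points of the segment from [p] to [x]. If [c > 0], it fails at
     [t = 1] when [q <= c], and at the minimiser [t = c / q] otherwise. *)
  have key t : 0 <= t <= 1 -> 0 <= t * (t * q - 2 * c).
    move=> t01; have := pmin (t *: x + (1 - t) *: p).
    rewrite inE => /(_ (convex_rV convD Dx Dp t01)).
    have -> : y - (t *: x + (1 - t) *: p) = a - t *: (x - p).
      by apply/rowP => i; rewrite !mxE; ring.
    rewrite -/a (dot_sqrB a) (dotZr a) (dotZr (t *: _)) (dotC (t *: _)) dotZr -/q -/c.
    by lra.
  have [qc|qc] := leP q c.
    by have := key 1; rewrite ler01 lexx => /(_ isT); lra.
  have q1 : 0 < q by lra.
  have cq01 : 0 <= c / q <= 1.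
    by rewrite divr_ge0 ?(ltW ax0)//= ler_pdivrMr// mul1r ltW.
  have := key _ cq01.
  rewrite divfK ?gt_eqF// => h.
  have : 0 < c / q by rewrite divr_gt0.
  by move: h; nra.
exists a, (dot a y - dot a a / 2); split=> //.
- move=> x /aP; rewrite dotBr => ax.
  have -> : dot a y = dot a a + dot a p by rewrite -dotDr /a subrK.
  by lra.
- by lra.
Qed.

End convexity.

(** * A polytope between a compact set and the boundary of a convex body *)

Section polytope.
Context {R : realType} {n : nat}.
Implicit Types (C Omega : set 'rV[R]_n.+1).

Definition polytope (m : nat) (a : nat -> 'rV[R]_n.+1) (b : nat -> R) :=
  [set x | forall i, (i < m)%N -> dot (a i) x <= b i].

(* The points whose [e]-ball lies in [Omega] form a compact convex set, from which
   the points outside [Omega°] can be separated strictly. *)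
Lemma polytope_between C Omega :
  compact Omega -> convex_set (Omega : set (convex_lmodType 'rV[R]_n.+1)) ->
  compact C -> C !=set0 -> C `<=` Omega° ->
  exists m a b, [/\ (0 < m)%N, forall i, (i < m)%N -> a i != 0,
    forall i x, (i < m)%N -> C x -> dot (a i) x < b i &
    polytope m a b `<=` Omega°].
Proof.
move=> cO convO cC [x0 Cx0] CO.
have [e e0 Ce] := compact_open_thicken cC (open_interior Omega) CO.
pose D : set 'rV[R]_n.+1 := [set x | forall w, `|w| <= e -> Omega (x + w)].
have DE : D = \bigcap_(w in [set w | `|w| <= e]) ((fun x => x + w) @^-1` Omega).
  by apply/seteqP; split.
have DO : D `<=` Omega° by move=> x Dx; apply/nbhs_ballP; exists e => //= y;
  rewrite mx_norm_ball /ball_ /= -normrN opprB => xy; rewrite -(subrK x y) addrC; exact/Dx/ltW.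
have cD : compact D.
  apply: (subclosed_compact _ cO); last by move=> x /DO/interior_subset.
  rewrite DE; apply: closed_bigI => w _; apply: preimage_closed.
    move=> x _; have cw : {for x, continuous (fun _ : 'rV[R]_n.+1 => w)}.
      exact: cst_continuous.
    by apply: (continuousD _ cw); exact: cvg_id.
  exact: compact_closed.
have convD : convex_set (D : set (convex_lmodType 'rV[R]_n.+1)).
  move=> x y t; rewrite !inE => Dx Dy w we.
  have t01 : 0 <= t%:num <= 1 by rewrite ge0/= le1.
  have := convex_rV convO (Dx w we) (Dy w we) t01.
  congr Omega; apply/rowP => i; rewrite !mxE /= /unstable.onem.
  ring.
have CD : C `<=` D by move=> x Cx w we; apply: interior_subset; exact: Ce.
have [M M0 OM] := compact_norm_le cO.
(* The part to be cut off. Restricting to a cube makes it compact, so finitely many separating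
   half-spaces are enough. *)
pose Q := [set x : 'rV[R]_n.+1 | `|x| <= M + 1] `&` ~` Omega°.
have cQ : compact Q.
  apply: bounded_closed_compact.
    by exists (M + 1); split=> [|t Mt x [/= xM _]]; rewrite ?num_real// (le_trans xM)// ltW.
  apply: closedI; last exact/open_closedC/open_interior.
  have -> : [set x : 'rV[R]_n.+1 | `|x| <= M + 1] = Num.norm @^-1` [set t | t <= M + 1] by [].
  apply: preimage_closed; last exact: closed_le.
  by move=> x _; exact: norm_continuous.
have sep y : {p : 'rV[R]_n.+1 * R | Q y ->
    [/\ p.1 != 0, forall x, D x -> dot p.1 x < p.2 & p.2 < dot p.1 y]}.
  apply: cid; have [Qy|Qy] := pselect (Q y); last by exists (0, 0).
  have D0 : D !=set0 by exists x0; exact: CD.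
  have Dy : ~ D y by move/DO; exact: Qy.2.
  by have [a [b abP]] := separation cD convD D0 Dy; exists (a, b).
pose f y := [set z | (sval (sep y)).2 < dot (sval (sep y)).1 z].
have of_ y : open (f y).
  have -> : f y = dot (sval (sep y)).1 @^-1` [set t | (sval (sep y)).2 < t] by [].
  apply: open_comp; last exact: open_gt.
  by move=> z _; exact: continuous_dot.
move: cQ; rewrite compact_cover => /(_ _ Q f (fun i _ => of_ i)).
case=> [y Qy|F FQ QF]; first by exists y => //; have [] := svalP (sep y) Qy.
(* The faces of the cube are added to confine the polytope to the region covered by [Q] and
   [Omega°]. The radius [M + 1] keeps [C] strictly inside them, and they make the list nonempty even
   when [F] is empty. *)
pose s := [seq sval (sep y) | y <- finmap.enum_fset F] ++
  [seq (delta_mx 0 i, M + 1) | i <- enum 'I_n.+1] ++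
  [seq (- delta_mx 0 i, M + 1) | i <- enum 'I_n.+1].
have dotd (i : 'I_n.+1) x : dot (delta_mx 0 i) x = x 0 i.
  rewrite /dot (bigD1 i)//= big1 ?addr0; first by rewrite mxE !eqxx mul1r.
  by move=> j ji; rewrite mxE (negbTE ji) andbF mul0r.
have d0 (i : 'I_n.+1) : delta_mx 0 i != 0 :> 'rV[R]_n.+1.
  by apply/eqP => /matrixP/(_ 0 i)/eqP; rewrite !mxE !eqxx oner_eq0.
have sP p : p \in s -> p.1 != 0 /\ forall x, C x -> dot p.1 x < p.2.
  rewrite !mem_cat => /or3P[] /mapP[y yF ->] /=.
  - have Qy : Q y by have := FQ _ yF; rewrite inE.
    have [h1 h2 _] := svalP (sep y) Qy; split=> // x /CD; exact: h2.
  - split=> // x /CO/interior_subset/OM xM; rewrite dotd.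
    have := coord_le_norm x y; have := ler_norm (x 0 y); lra.
  - split=> [|x /CO/interior_subset/OM xM]; first by rewrite oppr_eq0.
    rewrite dotNl dotd.
    have := coord_le_norm x y; have := ler_norm (- x 0 y); rewrite normrN; lra.
have sizes : (0 < size s)%N.
  by rewrite !size_cat !size_map -enumT size_enum_ord addnS addnC addSn.
exists (size s), (fun i => (nth (0, 0) s i).1), (fun i => (nth (0, 0) s i).2); split=> //.
- by move=> i si; have [] := sP _ (mem_nth (0, 0) si).
- by move=> i x si; have [_] := sP _ (mem_nth (0, 0) si); apply.
move=> x xs; have {}xs p : p \in s -> dot p.1 x <= p.2.
  by move=> /(nthP (0, 0))[i si <-]; exact: xs.
apply: contrapT => Ox.
have Qx : Q x.
  split=> //=; apply: rV_norm_le => [|i]; first by rewrite addr_ge0// ltW.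
  rewrite ler_norml lerNl; apply/andP; split.
    have := xs (- delta_mx 0 i, M + 1); rewrite dotNl dotd; apply.
    by rewrite !mem_cat map_f ?orbT// mem_enum.
  have := xs (delta_mx 0 i, M + 1); rewrite dotd; apply.
  by rewrite !mem_cat map_f ?orbT// mem_enum.
have [y yF] := QF _ Qx; rewrite /f /= ltNge xs//.
by rewrite !mem_cat map_f.
Qed.

End polytope.

(** * Support function and anisotropic inradius *)

Section support_function.
Context {R : realType} {n : nat}.
Variable K : set 'rV[R]_n.
Hypotheses (cK : compact K) (K0 : K !=set0).
Local Notation h := (support_function K).

Lemma support_function_attained x : exists2 y, K y & dot x y = h x.
Proof.
have [c + cmax] := EVT_max_rV K0 cK (continuous_subspaceT (@continuous_dot _ _ x)).
rewrite inE => Kc; exists c => //.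
have ubc : ubound [set dot x y | y in K] (dot x c).
  by move=> _ [y Ky <-]; apply: cmax; rewrite inE.
apply/eqP; rewrite eq_le; apply/andP; split.
  by apply: ub_le_sup; [exists (dot x c)|exists c].
by apply: ge_sup => //; exists (dot x c), c.
Qed.

Lemma dot_le_support x y : K y -> dot x y <= h x.
Proof.
move=> Ky; have [M _ KM] := compact_norm_le cK.
apply: ub_le_sup; last by exists y.
exists ((\sum_i `|x 0 i|) * M) => _ [z Kz <-].
apply: le_trans (ler_norm _) _; apply: le_trans (dot_norm_le _ _) _.
by rewrite ler_wpM2l ?sumr_ge0 ?KM.
Qed.

Lemma support_functionD x y : h (x + y) <= h x + h y.
Proof.
have [c Kc <-] := support_function_attained (x + y).
by rewrite dotDl lerD// dot_le_support.
Qed.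

Lemma support_function_norm_le : exists2 L, 0 < L & forall x, h x <= L * `|x|.
Proof.
have [M M0 KM] := compact_norm_le cK.
exists (n%:R * M + 1) => [|x].
  by rewrite ltr_pwDr// mulr_ge0// ltW.
have [c Kc <-] := support_function_attained x.
apply: le_trans (ler_norm _) _; apply: le_trans (dot_norm_le _ _) _.
rewrite mulrDl mul1r ler_wpDr// mulrAC; apply: ler_pM; rewrite ?sumr_ge0// ?KM//.
rewrite mulr_natl -[X in _ *+ X]card_ord -sumr_const.
by apply: ler_sum => i _; exact: coord_le_norm.
Qed.

Lemma support_function_continuous : continuous h.
Proof.
have [L L0 hL] := support_function_norm_le.
move=> x; apply/(@cvgrPdist_lt _ _ _ (nbhs x) (nbhs_filter x)) => e e0.
have eL : 0 < e / L by rewrite divr_gt0.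
have : \forall y \near x, ball x (e / L) y by exact: nbhsx_ballx.
apply: filterS => y; rewrite mx_norm_ball /ball_ /= => xy.
have xyL : L * `|x - y| < e by rewrite mulrC -ltr_pdivlMr.
have := support_functionD y (x - y); have := support_functionD x (y - x).
rewrite ![_ + (_ - _)]addrC !subrK.
have := hL (x - y); have := hL (y - x); rewrite -(distrC x y).
by move=> h1 h2 h3 h4; rewrite ltr_norml; apply/andP; split; lra.
Qed.

Hypothesis symK : origin_symmetric K.

Lemma abs_dot_le_support x y : K y -> `|dot x y| <= h x.
Proof.
move=> Ky; rewrite ler_norml lerNl -dotNr !dot_le_support//; exact: symK.
Qed.

Lemma support_function_ge0 x : 0 <= h x.
Proof. by have [y Ky] := K0; exact: le_trans (normr_ge0 _) (abs_dot_le_support x Ky). Qed.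

(** A ball around some [y] lies in [K], so [K] contains both [y + t x] and, by symmetry, [- y]. In
    the sum of the two resulting lower bounds for [h x] the terms [dot x y] cancel and [t * dot x x]
    remains. *)
Lemma support_function_gt0 x : K° !=set0 -> x != 0 -> 0 < h x.
Proof.
move=> [y /nbhs_ballP[r /= r0 yK]] x0.
have nx0 : 0 < `|x| by rewrite normr_gt0.
pose t := r / (2 * `|x|); have t0 : 0 < t by rewrite divr_gt0// mulr_gt0.
have Kyt : K (y + t *: x).
  apply: yK; rewrite mx_norm_ball /ball_ /= opprD addrA subrr sub0r normrN normrZ.
  by rewrite gtr0_norm// /t invfM mulrA divfK ?gt_eqF// ltr_pdivrMr// ltr_pMr// ltr1n.
have Ky : K y by apply: yK; exact: ballxx.
have := dot_le_support x Kyt; rewrite dotDr dotZr.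
have := dot_le_support x (symK Ky); rewrite dotNr.
by have := mulr_gt0 t0 (dot_gt0 x0); lra.
Qed.

(** The real supremum dominates its set only if that set is bounded. By symmetry both [z + s y] and
    [z - s y] lie in [Omega]; their difference [2 s y] then bounds [s], provided [y] is nonzero. *)
Lemma le_inradius (Omega : set 'rV[R]_n) (x : 'rV[R]_n) (t : R) : compact Omega -> (exists2 y, K y & y != 0) ->
  Omega x -> (forall y, K y -> Omega (x + t *: y)) -> t <= inradius K Omega.
Proof.
move=> cO [y Ky y0] Ox tKO; apply: ub_le_sup; last first.
  by exists x => // _ [z Kz <-]; exact: tKO.
have [M M0 OM] := compact_norm_le cO.
have ny0 : 0 < `|y| by rewrite normr_gt0.
exists (M / `|y|) => s [z Oz sKO]; rewrite ler_pdivlMr//.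
have p1 : `|z + s *: y| <= M by apply: OM; apply: sKO; exists y.
have p2 : `|z - s *: y| <= M.
  by rewrite -scalerN; apply: OM; apply: sKO; exists (- y) => //; exact: symK.
have : `|(2 * s) *: y| <= M + M.
  have -> : (2 * s) *: y = (z + s *: y) - (z - s *: y).
    by apply/rowP => i; rewrite !mxE; ring.
  exact: le_trans (ler_normB _ _) (lerD p1 p2).
rewrite normrZ normrM [`|2|]ger0_norm// => h1.
by have : s * `|y| <= `|s| * `|y| by [rewrite ler_wpM2r// ler_norm]; lra.
Qed.

End support_function.

(** * Directional derivatives from continuous partial derivatives *)

Section directional_derivative.
Context {R : realType} {n : nat}.
Implicit Types (f : 'rV[R]_n -> R) (x v : 'rV[R]_n).

Lemma is_derive_line f x v (s : R) : derivable f (x + s *: v) v ->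
  is_derive s (1 : R) (fun t => f (x + t *: v)) ('D_v f (x + s *: v)).
Proof.
move=> df.
have E : (fun h : R => h^-1 *: (((fun t => f (x + t *: v)) \o shift s) (h *: 1) -
      f (x + s *: v))) =
    (fun h => h^-1 *: ((f \o shift (x + s *: v)) (h *: v) - f (x + s *: v))).
  apply/funext => h /=; congr (_ *: (f _ - _)).
  by rewrite scalerDl [_ *: 1]mulr1 addrCA addrC -addrA addrC -addrA addrC.
by split; [rewrite /derivable E|rewrite /derive E].
Qed.

Definition C1 f := (forall x i, derivable f x (delta_mx 0 i)) /\
  (forall i, continuous (partial i f)).

Lemma partial_mean_value f x i (t : R) : C1 f -> exists2 s : R, `|s| <= `|t| &
  f (x + t *: delta_mx 0 i) - f x = partial i f (x + s *: delta_mx 0 i) * t.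
Proof.
move=> [df _].
have dl s : is_derive s (1 : R) (fun u => f (x + u *: delta_mx 0 i))
    (partial i f (x + s *: delta_mx 0 i)) by exact: is_derive_line.
have cl : continuous (fun u : R => f (x + u *: delta_mx 0 i)).
  by move=> u; apply: differentiable_continuous; apply/derivable1_diffP.
have [t0|t0] := leP 0 t.
  have [s] := MVT_segment t0 (fun s _ => dl s) (continuous_subspaceT cl).
  rewrite in_itv/= scale0r addr0 subr0 => /andP[s0 st] ->.
  by exists s; rewrite // !ger0_norm.
have [s] := MVT_segment (ltW t0) (fun s _ => dl s) (continuous_subspaceT cl).
rewrite in_itv/= scale0r addr0 sub0r => /andP[s0 st] E.
exists s; first by rewrite (ler0_norm st) (ler0_norm (ltW t0)) lerN2.
by rewrite -opprB E mulrN opprK.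
Qed.

(* By the mean value theorem the increment of [f] along the last coordinate is
   governed by a value of the continuous function [partial i f] near [x]. *)
Lemma is_derive_addr_delta f x v i (a l : R) : C1 f -> is_derive x v f l ->
  is_derive x (v + a *: delta_mx 0 i) f (l + a * partial i f x).
Proof.
move=> C1f [dv <-]; pose e : 'rV[R]_n := delta_mx 0 i.
pose q w (h : R) := h^-1 *: ((f \o shift x) (h *: w) - f x).
have cq : q v h @[h --> 0^'] --> 'D_v f x by [].
pose p (h : R) := h^-1 *: (f (x + h *: v + (h * a) *: e) - f (x + h *: v)).
have [_ /(_ i x) cp] := C1f.
have cpl : p h @[h --> 0^'] --> a * partial i f x.
  have [a0|a0] := eqVneq a 0.
    rewrite a0 mul0r (_ : p = cst 0); first exact: cvg_cst.
    by apply/funext => h; rewrite /p a0 mulr0 scale0r addr0 subrr scaler0.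
  apply/cvgrPdist_lt => eps eps0.
  have ea : 0 < eps / `|a| by rewrite divr_gt0// normr_gt0.
  have /nbhs_ballP[r /= r0 xr] : \forall y \near x, `|partial i f x - partial i f y| < eps / `|a|.
    by move/(@cvgrPdist_lt _ _ _ (nbhs x) (nbhs_filter x)) : cp; apply.
  (* [c] bounds the displacement from [x] per unit of [h], so [|h| < r / c] keeps the intermediate
     point within [r] of [x]. *)
  pose c := `|v| + `|a| * `|e| + 1.
  have c0 : 0 < c by rewrite ltr_wpDl// addr_ge0// mulr_ge0.
  exists (r / c) => /=; first by rewrite divr_gt0.
  move=> h /=; rewrite sub0r normrN ltr_pdivlMr// => hr h0.
  have [s sha E] := partial_mean_value (x + h *: v) i (h * a) C1f.
  rewrite /p E [_ *: _]mulrC -mulrA [h * a]mulrC mulrK ?unitfE// [_ * a]mulrC -mulrBr normrM.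
  rewrite -ltr_pdivlMl ?normr_gt0// mulrC; apply: xr.
  rewrite mx_norm_ball /ball_ /= -addrA opprD addrA subrr sub0r normrN.
  apply: le_lt_trans hr; apply: le_trans (ler_normD _ _) _.
  rewrite !normrZ /c !mulrDr mulr1 mulrA -normrM -/e.
  by rewrite -addrA lerD2l ler_wpDr// ler_wpM2r.
have E : q (v + a *: e) = (fun h => q v h + p h).
  apply/funext => h; rewrite /q /p /= -scalerDr; congr (_ *: _).
  rewrite ![h *: _ + x]addrC scalerDr scalerA addrA; ring.
have cqe : q (v + a *: e) h @[h --> 0^'] --> 'D_v f x + a * partial i f x.
  by rewrite E; exact: cvgD.
split; first by apply/cvg_ex; exists ('D_v f x + a * partial i f x).
exact/cvg_lim.
Qed.

Definition grad f x : 'rV[R]_n := \row_i partial i f x.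

(** [C1] speaks of the basis directions only; the derivative along [v] is assembled by adding its
    coordinates one at a time. *)
Lemma is_derive_grad f x v : C1 f -> is_derive x v f (dot (grad f x) v).
Proof.
move=> C1f.
pose w (r : seq 'I_n) : 'rV[R]_n := \sum_(i <- r) v 0 i *: delta_mx 0 i.
have dw r : is_derive x (w r) f (\sum_(i <- r) v 0 i * partial i f x).
  elim: r => [|i r IH].
    rewrite /w !big_nil; have E : (fun h : R => h^-1 *: ((f \o shift x) (h *: 0) - f x)) = cst 0.
      by apply/funext => h; rewrite /= scaler0 add0r subrr scaler0.
    split; first by rewrite /derivable E; exact: is_cvg_cst.
    by rewrite /derive E; apply: cvg_lim => //; exact: cvg_cst.
  rewrite /w !big_cons addrC [X in is_derive _ _ _ X]addrC.
  exact: is_derive_addr_delta.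
have -> : dot (grad f x) v = \sum_i v 0 i * partial i f x.
  by apply: eq_bigr => i _; rewrite mxE mulrC.
have wv : w (index_enum 'I_n) = v by exact/esym/row_sum_delta.
by have := dw (index_enum 'I_n); rewrite wv.
Qed.

End directional_derivative.

(** * Partition of a polytope by the nearest face *)

Section nearest_facet.
Context {R : realType} {n : nat}.
Variables (m : nat) (d : nat -> 'rV[R]_n -> R).

(** Ties go to the smallest index, so the pieces are genuinely disjoint and no null set has to be
    discarded. *)
Definition nearest_facet i : set 'rV[R]_n :=
  [set x | (forall j, (j < m)%N -> 0 <= d j x /\ d i x <= d j x) /\
           (forall j, (j < i)%N -> d i x < d j x)].

Lemma measurable_nearest_facet i : (forall j, measurable_fun setT (d j)) ->
  measurable (nearest_facet i).
Proof.
move=> md; pose E j := d j @^-1` `[0, +oo[%classic `&`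
  (fun x => d j x - d i x) @^-1` `[0, +oo[%classic.
pose F j := (fun x => d j x - d i x) @^-1` `]0, +oo[%classic.
have -> : nearest_facet i = (\bigcap_(j in `I_m) E j) `&` (\bigcap_(j in `I_i) F j).
  apply/seteqP; split => x /= [h1 h2]; split => j jm.
  - by have [] := h1 j jm; rewrite /E /= !in_itv/= !andbT subr_ge0.
  - by rewrite /F /= in_itv/= andbT subr_gt0; exact: h2.
  - by have := h1 j jm; rewrite /E /= !in_itv/= !andbT subr_ge0.
  - by have := h2 j jm; rewrite /F /= !in_itv/= !andbT subr_gt0.
apply: measurableI.
  apply: fin_bigcap_measurable => [|j _]; first exact: finite_II.
  apply: measurableI; rewrite -[X in measurable X]setTI; first exact: md.
  exact: measurable_funB.
apply: fin_bigcap_measurable => [|j _]; first exact: finite_II.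
by rewrite -[X in measurable X]setTI; exact: measurable_funB.
Qed.

Lemma trivIset_nearest_facet : trivIset [set` iota 0 m] nearest_facet.
Proof.
have key i j x : (i < j)%N -> (j < m)%N -> nearest_facet i x -> nearest_facet j x -> False.
  by move=> ij jm [/(_ j jm) [_]]; rewrite leNgt => /negP + _ [_] /(_ i ij).
move=> i j; rewrite /= !mem_iota !add0n /= => im jm [x [ix jx]].
by case: (ltngtP i j) => // ij; exfalso; [exact: (key i j x)|exact: (key j i x)].
Qed.

Lemma bigcup_nearest_facet : (0 < m)%N ->
  \big[setU/set0]_(i <- iota 0 m) nearest_facet i =
  [set x | forall j, (j < m)%N -> 0 <= d j x].
Proof.
move=> m0; rewrite -bigcup_seq; apply/seteqP; split=> x /=.
  by move=> [i _ [ix _]] j jm; have [] := ix j jm.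
move=> x0; pose i0 : 'I_m := Ordinal m0.
(* The least index attaining the minimum is the one that satisfies the tie-breaking clause. *)
pose P i := (i < m)%N && [forall j : 'I_m, d i x <= d j x].
have exP : exists i, P i.
  have [/= i _ imin] := @Order.TotalTheory.arg_minP _ _ _ i0 xpredT (fun i : 'I_m => d i x) isT.
  by exists i; rewrite /P ltn_ord; apply/forallP => j; exact: imin.
case: (ex_minnP exP) => i /andP[im /forallP imin] ileast.
exists i; first by rewrite /= mem_iota add0n.
split=> j jm; first by split; [exact: x0|exact: (imin (Ordinal jm))].
rewrite ltNge; apply/negP => ji.
have : P j.
  apply/andP; split; first exact: ltn_trans im.
  by apply/forallP => k; exact: le_trans (imin k).
by move=> /ileast; rewrite leqNgt jm.
Qed.

End nearest_facet.

(** * Test functions along a flow line *)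

Section test_functions.
Context {R : realType} {n : nat}.
Local Notation mu := (@lebesgue_rV R n).
Local Notation leb := lebesgue_measure.
Implicit Types (f : 'rV[R]_n -> R) (O : set 'rV[R]_n).

Lemma test_functionC1 O f : test_function O f -> C1 f.
Proof.
move=> [Cf _ _]; have [_ C1f] := Cf 1%N.
split=> [x i|i x]; first by have [df _] := C1f i; exact: df.
by have [_ [cf _]] := C1f i; exact: cf.
Qed.

Lemma test_function_continuous O f : test_function O f -> continuous f.
Proof. by move=> [Cf _ _] x; have [cf _] := Cf 0%N; exact: cf. Qed.

Lemma measurable_grad f : C1 f -> measurable_fun setT (grad f).
Proof.
move=> [_ cf]; apply: measurable_fun_rVP => i.
by under eq_fun do rewrite mxE; exact: continuous_measurable_rV.
Qed.

Lemma continuous_line (x v : 'rV[R]_n) : continuous (fun s : R => x + s *: v).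
Proof.
move=> s; have cx : {for s, continuous (fun _ : R => x)} by exact: cst_continuous.
apply: (continuousD cx); exact: scalel_continuous.
Qed.

Variable K : set 'rV[R]_n.
Hypotheses (cK : compact K) (K0 : K !=set0) (symK : origin_symmetric K).
Local Notation h := (support_function K).

Lemma measurable_support_grad f : C1 f -> measurable_fun setT (fun x => h (grad f x)).
Proof.
move=> C1f; have mh : measurable_fun setT h.
  by apply: continuous_measurable_rV; exact: support_function_continuous.
exact: (measurableT_comp mh (measurable_grad C1f)).
Qed.

(** As [f] vanishes at the far end, [- f y] is the integral of the derivative along [v]; since [v]
    lies in the symmetric set [K], that derivative is bounded in absolute value by the support
    function of the gradient. *)
Lemma line_integral_support f (y v : 'rV[R]_n) (d : R) : C1 f -> K v -> 0 <= d ->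
  f (y + d *: v) = 0 ->
  (`|f y|%:E <= \int[leb]_(s in `[0%R, d]) (h (grad f (y + s *: v)))%:E)%E.
Proof.
move=> C1f Kv d0 f0.
have h0 z : 0 <= h z by exact: support_function_ge0.
have [de|dn] := eqVneq d 0.
  rewrite -[y]addr0 -(scale0r v) -de f0 normr0.
  by apply: integral_ge0 => s _; rewrite lee_fin.
pose g s := dot (grad f (y + s *: v)) v.
have cg : continuous g.
  apply: continuous_big => [|i _ s]; first exact: add_continuous.
  have cv : {for s, continuous (fun _ : R => v 0 i)} by exact: cst_continuous.
  apply: (continuousM _ cv).
  rewrite (_ : (fun _ => _) = (partial i f \o (fun t : R => y + t *: v))); last first.
    by apply/funext => t; rewrite mxE.
  apply: continuous_comp; first exact: continuous_line.
  exact: C1f.2.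
have dF (s : R) : is_derive s (1 : R) (fun t => f (y + t *: v)) (g s).
  have [df E] := is_derive_grad (y + s *: v) v C1f.
  by rewrite /g -E; exact: is_derive_line.
have cF : continuous (fun t : R => f (y + t *: v)).
  by move=> u; apply: differentiable_continuous; apply/derivable1_diffP.
have dpos : 0 < d by rewrite lt_neqAle eq_sym dn.
have FTC : (\int[leb]_(s in `[0%R, d]) (g s)%:E = (- f y)%:E)%E.
  rewrite (@continuous_FTC2 _ g (fun t => f (y + t *: v)) _ _ dpos).
  - by rewrite f0 scale0r addr0 -EFinB sub0r.
  - exact: continuous_subspaceT.
  - split=> [s _| |]; first exact: ex_derive.
      by apply: cvg_at_right_filter; exact: cF.
    by apply: cvg_at_left_filter; exact: cF.
  - by move=> s _; rewrite derive1E; exact: derive_val.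
have mg : measurable_fun (`[0, d]%classic : set R) (EFin \o g).
  apply/measurable_EFinP; apply: measurable_funTS; exact: continuous_measurable_fun.
have -> : (`|f y|%:E = `|\int[leb]_(s in `[0%R, d]) (g s)%:E|)%E by rewrite FTC abse_EFin normrN.
apply: (@le_trans _ _ (\int[leb]_(s in `[0%R, d]) `|(g s)%:E|)%E).
  exact: le_abse_integral.
apply: ge0_le_integral => //.
- exact: measurableT_comp.
- have ml : measurable_fun [set: measurableTypeR R] (fun s => y + s *: v).
    apply: measurable_fun_rVP => i; under eq_fun do rewrite !mxE.
    by apply: measurable_funD => //; exact: measurable_funM.
  apply/measurable_EFinP/measurable_funTS.
  exact: (measurableT_comp (measurable_support_grad C1f) ml).
by move=> s _; rewrite lee_fin; exact: abs_dot_le_support.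
Qed.

End test_functions.

(** * The integral inequality for test functions *)

Section test_function_energy.
Context {R : realType} {n : nat}.
Local Notation mu := (@lebesgue_rV R n.+1).
Variables K Omega : set 'rV[R]_n.+1.
Hypotheses (K_body : convex_body K) (symK : origin_symmetric K)
  (Omega_body : convex_body Omega).
Local Notation h := (support_function K).
Local Notation r := (inradius K Omega).

Let cK : compact K. Proof. by case: K_body. Qed.
Let intK : K° !=set0. Proof. by case: K_body. Qed.
Let K0 : K !=set0. Proof. by have [x /interior_subset] := intK; exists x. Qed.
Let cO : compact Omega. Proof. by case: Omega_body. Qed.
Let convO : convex_set (Omega : set (convex_lmodType 'rV[R]_n.+1)).
Proof. by case: Omega_body. Qed.

Let K_neq0 : exists2 y, K y & y != 0.
Proof.
have e0 : const_mx 1 != 0 :> 'rV[R]_n.+1.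
  by apply/eqP => /rowP/(_ 0); rewrite !mxE => /eqP; rewrite oner_eq0.
have [y Ky E] := support_function_attained cK K0 (const_mx 1).
exists y => //; apply/eqP => y0; have := support_function_gt0 cK symK intK e0.
by rewrite -E y0 -(scale0r (0 : 'rV[R]_n.+1)) dotZr mul0r ltxx.
Qed.

Lemma test_function_young f (c : R) : test_function Omega° f -> 0 < c ->
  (\int[mu]_(x in Omega°) `|f x|%:E <=
   (r ^+ 2 / (6 * c))%:E * mu Omega° +
   (c / 2)%:E * \int[mu]_(x in Omega°) (h (grad f x) ^+ 2)%:E)%E.
Proof.
move=> tf c0; have C1f := test_functionC1 tf.
have cf := test_function_continuous tf; case: (tf) => _ cC CO.
have mf : measurable_fun setT f by exact: continuous_measurable_rV.
have mG := measurable_support_grad cK K0 C1f.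
have G0 x : 0 <= h (grad f x) by exact: support_function_ge0.
have f0 x : ~ closure [set x | f x != 0] x -> f x = 0.
  by apply: contra_notP => /eqP fx; exact: subset_closure.
have mO : measurable Omega° by apply: open_measurable_rV; exact: open_interior.
set E := closure _ in cC CO f0.
have rhs0 (A : set 'rV[R]_n.+1) : (0 <= (r ^+ 2 / (6 * c))%:E * mu A +
   (c / 2)%:E * \int[mu]_(x in A) (h (grad f x) ^+ 2)%:E)%E.
  have := sqr_ge0 r; move=> r2; apply: adde_ge0; apply: mule_ge0 => //.
  - by rewrite lee_fin divr_ge0// mulr_ge0// ltW.
  - by rewrite lee_fin divr_ge0// ltW.
  - by apply: integral_ge0 => x _; rewrite lee_fin sqr_ge0.
have [[x0 Ex0]|/set0P/negP/negPn/eqP E0] := pselect (E !=set0); last first.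
  rewrite integral0_eq// => x _; rewrite f0 ?normr0//.
  by rewrite E0.
have [m [a [b [m0 a0 Eab PO]]]] := polytope_between cO convO cC (ex_intro _ x0 Ex0) CO.
have ha i : (i < m)%N -> 0 < h (a i) by move=> im; exact: (support_function_gt0 cK symK intK (a0 i im)).
pose d i x := (b i - dot (a i) x) / h (a i).
have md i : measurable_fun setT (d i).
  apply: measurable_funM => //; apply: measurable_funB => //.
  by apply: continuous_measurable_rV; exact: continuous_dot.
have d_ge0 i x : (i < m)%N -> (0 <= d i x) = (dot (a i) x <= b i).
  by move=> im; rewrite /d pmulr_lge0 ?invr_gt0 ?ha// subr_ge0.
have dD i x y : d i (x + y) = d i x - dot (a i) y / h (a i).
  by rewrite /d dotDr -mulrBl opprD addrA.
(* Unit speed bound: [dot (a i) y <= h (a i)] for [y] in [K]. The maximiser [v i] chosen below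
   attains it. *)
have dK i x y s : (i < m)%N -> K y -> 0 <= s -> d i x - s <= d i (x + s *: y).
  move=> im Ky s0; rewrite dD dotZr lerB// -mulrA ler_piMr//.
  by rewrite ler_pdivrMr ?ha// mul1r dot_le_support.
have vP i : {v | (i < m)%N -> K v /\ dot (a i) v = h (a i)}.
  apply: cid; have [v Kv E'] := support_function_attained cK K0 (a i).
  by exists v.
pose v i := sval (vP i).
pose A i := nearest_facet m d i.
have dv i x s : (i < m)%N -> d i (x + s *: v i) = d i x - s.
  move=> im; have [_ E'] := svalP (vP i) im.
  by rewrite dD dotZr E' mulfK// gt_eqF// ha.
have mA i : measurable (A i) by exact: measurable_nearest_facet.
have AP i x : (i < m)%N -> A i x -> polytope m a b x.
  by move=> im [xP _] j jm; have [] := xP j jm; rewrite d_ge0.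
have bigA : \big[setU/set0]_(i <- iota 0 m) A i = polytope m a b.
  rewrite bigcup_nearest_facet//; apply/seteqP; split=> x xP j jm.
    by rewrite -d_ge0// xP.
  by rewrite d_ge0// xP.
have piece i : (i < m)%N ->
  (\int[mu]_(x in A i) `|f x|%:E <= \int[mu]_(x in A i)
    ((r ^+ 2 / (6 * c))%:E + (c / 2)%:E * (h (grad f x) ^+ 2)%:E))%E.
  move=> im; have [Kv _] := svalP (vP i) im.
  rewrite ge0_integralD//; last 3 first.
  - by move=> x _; rewrite lee_fin divr_ge0 ?sqr_ge0// mulr_ge0// ltW.
  - by move=> x _; rewrite mule_ge0// lee_fin ?sqr_ge0// divr_ge0// ltW.
  - apply/measurable_funTS; apply: measurable_funeM.
    exact/measurable_EFinP/measurable_funX.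
  rewrite integral_cst// ge0_integralZl//; last 3 first.
  - exact/measurable_EFinP/measurable_funTS/measurable_funX.
  - by move=> x _; rewrite lee_fin sqr_ge0.
  - by rewrite lee_fin divr_ge0// ltW.
  apply: (@flow_young _ _ (A i) (v i) (d i) r) => //.
  - by move=> x s; exact: dv.
  (* Moving by [d i x *: y] with [y] in [K] lowers each [d j] by at most [d i x <= d j x], so the
     scaled copy of [K] stays in the polytope, hence in [Omega]. *)
  - move=> x Ax; have [xP _] := Ax; have [-> _] := xP i im.
    apply: (le_inradius symK cO K_neq0).
      by apply: interior_subset; apply: PO; exact: AP Ax.
    move=> y Ky; apply: interior_subset; apply: PO => j jm; rewrite -d_ge0//.
    have [_ xij] := xP j jm; have [di0 _] := xP i im.
    by apply: le_trans (dK _ _ _ _ jm Ky di0); rewrite subr_ge0.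
  (* [d i] loses exactly [s] and every other [d j] at most [s], so both the weak and the strict
     comparisons persist. *)
  - move=> x s [xP xlt] /andP[s0 sd]; split=> j jm; rewrite dv//.
      have [_ xij] := xP j jm; have := dK j x _ s jm Kv s0; lra.
    have jm' := ltn_trans jm im; have := dK j x _ s jm' Kv s0.
    by have := xlt j jm; lra.
  (* The exit point has [d i = 0], whereas [d i] is positive on the support of [f]; hence [f]
     vanishes there. *)
  - move=> y Ay; have [yP _] := Ay; have [di0 _] := yP i im.
    apply: (line_integral_support cK K0 symK C1f Kv di0).
    apply: f0 => /(Eab i _ im); rewrite -subr_gt0 => db.
    have : 0 < d i (y + d i y *: v i) by rewrite divr_gt0// ha.
    by rewrite dv// subrr ltxx.
have intP : (\int[mu]_(x in Omega°) `|f x|%:E = \int[mu]_(x in polytope m a b) `|f x|%:E)%E.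
  rewrite !(integral_mkcond _ (fun x => `|f x|%:E)); apply: eq_integral => x _.
  rewrite /patch; case: ifPn; case: ifPn => //; rewrite ?inE ?notin_setE.
    by move=> Px _; rewrite f0 ?normr0// => Ex; apply: Px => j jm; exact/ltW/Eab.
  by move=> /PO.
have mP : measurable (polytope m a b) by rewrite -bigA; exact: bigsetU_measurable.
have mrhs : measurable_fun setT
    (fun x => (r ^+ 2 / (6 * c))%:E + (c / 2)%:E * (h (grad f x) ^+ 2)%:E)%E.
  apply: emeasurable_funD => //; apply: measurable_funeM.
  exact/measurable_EFinP/measurable_funX.
have rhs_ge0 x : (0 <= (r ^+ 2 / (6 * c))%:E + (c / 2)%:E * (h (grad f x) ^+ 2)%:E)%E.
  by rewrite adde_ge0 ?mule_ge0// lee_fin ?sqr_ge0 ?divr_ge0 ?sqr_ge0 ?mulr_ge0 ?(ltW c0).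
have tA : trivIset [set` iota 0 m] A by exact: trivIset_nearest_facet.
apply: (@le_trans _ _ (\int[mu]_(x in polytope m a b)
    ((r ^+ 2 / (6 * c))%:E + (c / 2)%:E * (h (grad f x) ^+ 2)%:E))%E).
  rewrite intP -bigA ge0_integral_bigsetU ?iota_uniq//; last first.
    exact/measurable_EFinP/measurable_funTS/measurableT_comp.
  rewrite ge0_integral_bigsetU ?iota_uniq//; last exact: measurable_funTS.
  rewrite big_seq [leRHS]big_seq; apply: lee_sum => i; rewrite mem_iota add0n.
  exact: piece.
apply: (@le_trans _ _ (\int[mu]_(x in Omega°)
    ((r ^+ 2 / (6 * c))%:E + (c / 2)%:E * (h (grad f x) ^+ 2)%:E))%E).
  by apply: ge0_subset_integral => //; exact: measurable_funTS.
rewrite ge0_integralD//; last 3 first.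
- by move=> x _; rewrite lee_fin divr_ge0 ?sqr_ge0// mulr_ge0// ltW.
- by move=> x _; rewrite mule_ge0// lee_fin ?sqr_ge0// divr_ge0// ltW.
- apply/measurable_funTS; apply: measurable_funeM.
  exact/measurable_EFinP/measurable_funX.
rewrite integral_cst// ge0_integralZl//; last 3 first.
- exact/measurable_EFinP/measurable_funTS/measurable_funX.
- by move=> x _; rewrite lee_fin sqr_ge0.
by rewrite lee_fin divr_ge0// ltW.
Qed.

End test_function_energy.

(** * Passage from test functions to the Sobolev space *)

Lemma rV_norm_sqr_le {R : realType} n (x : 'rV[R]_n) : `|x| ^+ 2 <= \sum_i x 0 i ^+ 2.
Proof.
have s0 : 0 <= \sum_i x 0 i ^+ 2 by apply: sumr_ge0 => i _; exact: sqr_ge0.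
rewrite -[leRHS]sqr_sqrtr// ler_sqr ?nnegrE ?sqrtr_ge0//.
apply: rV_norm_le => [|i]; first exact: sqrtr_ge0.
rewrite -sqrtr_sqr ler_sqrt// (bigD1 i)//= lerDl.
by apply: sumr_ge0 => j _; exact: sqr_ge0.
Qed.

Section L2_convergence.
Context {R : realType} {n : nat}.
Local Notation mu := (@lebesgue_rV R n).
Implicit Types (O : set 'rV[R]_n) (u f : 'rV[R]_n -> R) (g : 'rV[R]_n -> 'rV[R]_n).

Lemma L2_measurable O u : measurable O -> L2 O u -> measurable_fun O u.
Proof.
move=> mO Lu; apply: (iffRL (measurable_restrictT u mO)).
by have := sub_Lfun_mfun Lu; rewrite inE.
Qed.

Lemma L2_cvg_near O (us : ('rV[R]_n -> R)^nat) u (e : R) : L2_cvg O us u -> 0 < e ->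
  \forall k \near \oo, (\int[mu]_(x in O) ((us k x - u x) ^+ 2)%:E <= e%:E)%E.
Proof.
move=> /fine_cvgP[fin cv] e0; have se0 : 0 < Num.sqrt e by rewrite sqrtr_gt0.
have lt_se : \forall k \near \oo, fine 'N[mu]_2%:E[EFin \o ((us k \- u) \_ O)%R]%E < Num.sqrt e.
  exact: (@cvgr_lt _ _ _ _ _ _ cv _ se0).
apply: filterS2 fin lt_se => k {}fin /= lt.
have -> : (\int[mu]_(x in O) ((us k x - u x) ^+ 2)%:E =
    'N[mu]_2%:E[EFin \o ((us k \- u) \_ O)%R] `^ 2)%E.
  rewrite poweR_Lnorm// [LHS]integral_mkcond; apply: eq_integral => x _ /=.
  rewrite powR_mulrn// real_normK ?num_real// /patch.
  by case: ifPn => //; rewrite expr0n.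
have N0 : (0 <= 'N[mu]_2%:E[EFin \o ((us k \- u) \_ O)%R])%E by exact: Lnorm_ge0.
rewrite -(fineK fin) poweR_EFin powR_mulrn ?fine_ge0// lee_fin.
rewrite -[leRHS]sqr_sqrtr ?(ltW e0)// ler_sqr ?nnegrE ?fine_ge0 ?(ltW se0)//.
exact: ltW.
Qed.

End L2_convergence.

Section sobolev_energy.
Context {R : realType} {n : nat}.
Local Notation mu := (@lebesgue_rV R n.+1).
Variables K Omega : set 'rV[R]_n.+1.
Hypotheses (K_body : convex_body K) (symK : origin_symmetric K)
  (Omega_body : convex_body Omega).
Local Notation h := (support_function K).
Local Notation r := (inradius K Omega).
Local Notation O := (Omega°).

Let cK : compact K. Proof. by case: K_body. Qed.
Let K0 : K !=set0.
Proof. by case: K_body => _ _ [x /interior_subset]; exists x. Qed.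
Let mO : measurable O.
Proof. by apply: open_measurable_rV; exact: open_interior. Qed.

Lemma measurable_support_comp (g : 'rV[R]_n.+1 -> 'rV[R]_n.+1) : (forall i, L2 O (fun x => g x 0 i)) ->
  measurable_fun O (fun x => h (g x)).
Proof.
move=> Lg; pose g' x : 'rV[R]_n.+1 := \row_i ((fun x => g x 0 i) \_ O) x.
have mh : measurable_fun setT h.
  by apply: continuous_measurable_rV; exact: support_function_continuous.
have mg' : measurable_fun setT g'.
  apply: measurable_fun_rVP => i; under eq_fun do rewrite mxE.
  by have := sub_Lfun_mfun (Lg i); rewrite inE.
apply: (eq_measurable_fun (h \o g')).
  move=> x xO /=; congr h; apply/rowP => i.
  by rewrite mxE /patch xO.
exact/measurable_funTS/measurableT_comp.
Qed.

(** Density with explicit errors: one approximating test function [f], close enough to [u] in both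
    function and gradient, costs at most a prescribed [e0] on the right-hand side. *)
Lemma sobolev_young u g (c : R) : (mu O < +oo)%E -> W12_0 O u g -> 0 < c ->
  (\int[mu]_(x in O) `|u x|%:E <=
   (r ^+ 2 / (6 * c))%:E * mu O +
   (c / 2)%:E * \int[mu]_(x in O) (h (g x) ^+ 2)%:E)%E.
Proof.
move=> finO [[Lu Lg _] [phi [tphi cu cg]]] c0.
have mhg := measurable_support_comp Lg.
have mh2 : measurable_fun O (fun x => (h (g x) ^+ 2)%:E).
  exact/measurable_EFinP/measurable_funX.
have mu_ : measurable_fun O u by exact: L2_measurable.
have mg i : measurable_fun O (fun x => g x 0 i) by exact: L2_measurable.
have [L L0 hL] := support_function_norm_le cK K0.
have h0 x : 0 <= h x by exact: support_function_ge0.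
set Y := (\int[mu]_(x in O) (h (g x) ^+ 2)%:E)%E.
have Y0 : (0 <= Y)%E by apply: integral_ge0 => x _; rewrite lee_fin sqr_ge0.
have alpha0 : 0 <= r ^+ 2 / (6 * c) by rewrite divr_ge0 ?sqr_ge0// mulr_ge0// ltW.
have c20 : 0 < c / 2 by rewrite divr_gt0.
have [Yoo|Yfin] := eqVneq Y +oo%E.
  by rewrite Yoo gt0_muley ?lte_fin// addey ?leey// -ltNye; apply: lt_le_trans (mule_ge0 _ _).
have V0 : (0 <= mu O)%E by exact: measure_ge0.
have Vfin : mu O \is a fin_num by rewrite ge0_fin_numE.
have {}Yfin : Y \is a fin_num by rewrite ge0_fin_numE// lt_neqAle Yfin leey.
pose V' := fine (mu O); pose Y' := fine Y.
have VE : (mu O <= V'%:E)%E by rewrite /V' fineK.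
have V'0 : 0 <= V' by exact: fine_ge0.
have Y'0 : 0 <= Y' by exact: fine_ge0.
apply/lee_addgt0Pr => e0 e0_gt0.
(* [e * D] is the total error: [e * (c / 2 * Y') + e] from the energy and [e / 2 * V' + e] from the
   L1 norm. *)
pose D := c / 2 * Y' + V' / 2 + 2.
have D0 : 0 < D by rewrite /D; have := mulr_ge0 (ltW c20) Y'0; lra.
pose e := e0 / D; have e_gt0 : 0 < e by rewrite divr_gt0.
have eD : e * D = e0 by rewrite divfK ?gt_eqF.
clearbody e.
pose M := (1 + e^-1) * L ^+ 2 * n.+1%:R.
have M0 : 0 < M by rewrite !mulr_gt0 ?exprn_gt0// addr_gt0// invr_gt0.
(* Tolerances chosen so that [d1 / (2e) = e] and [M * d2 = e / (c / 2)], where [M] is the factor by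
   which the squared L2 errors of the partials enter the energy. *)
pose d1 := 2 * e * e; pose d2 := e / (c / 2 * M).
have d10 : 0 < d1 by rewrite !mulr_gt0.
have d20 : 0 < d2 by rewrite divr_gt0// mulr_gt0.
have ng : \forall k \near \oo, forall i : 'I_n.+1, (\int[mu]_(x in O)
    ((partial i (phi k) x - g x 0 i) ^+ 2)%:E <= d2%:E)%E.
  by apply: filter_forall => i; exact: (L2_cvg_near (cg i) d20).
have [k [ku kg]] := filter_ex (filterI (L2_cvg_near cu d10) ng).
move: (phi k) (tphi k) ku kg => f tf ku kg.
have C1f := test_functionC1 tf.
have mf : measurable_fun O f.
  by apply: measurable_funTS; apply: continuous_measurable_rV; exact: (test_function_continuous tf).
have mp i : measurable_fun O (partial i f).
  by apply: measurable_funTS; apply: continuous_measurable_rV; exact: C1f.2.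
have mG := measurable_support_grad cK K0 C1f.
have mG2 : measurable_fun O (fun x => (h (grad f x) ^+ 2)%:E).
  exact/measurable_EFinP/measurable_funTS/measurable_funX.
have mpg i : measurable_fun O (fun x => ((partial i f x - g x 0 i) ^+ 2)%:E).
  by apply/measurable_EFinP/measurable_funX/measurable_funB.
have mfu : measurable_fun O (fun x => ((f x - u x) ^+ 2)%:E).
  by apply/measurable_EFinP/measurable_funX/measurable_funB.
(* L1 closeness follows from L2 closeness on a set of finite measure, through
   [|w| <= e/2 + w^2 / (2e)] with [w = f - u]. *)
have step1 : (\int[mu]_(x in O) `|u x|%:E <=
    \int[mu]_(x in O) `|f x|%:E + (e / 2 * V' + e)%:E)%E.
  apply: (@le_trans _ _ (\int[mu]_(x in O)
    (`|f x|%:E + ((e / 2)%:E + (2 * e)^-1%:E * ((f x - u x) ^+ 2)%:E)))%E).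
    apply: ge0_le_integral => //.
    - exact/measurable_EFinP/measurableT_comp.
    - apply: emeasurable_funD; first exact/measurable_EFinP/measurableT_comp.
      by apply: emeasurable_funD => //; exact: measurable_funeM.
    move=> x _; rewrite -EFinM -!EFinD lee_fin.
    have := ler_normB (f x) (f x - u x); rewrite subKr.
    suff : `|f x - u x| <= e / 2 + (2 * e)^-1 * (f x - u x) ^+ 2 by lra.
    rewrite -(real_normK (num_real (f x - u x))) -subr_ge0.
    have -> : e / 2 + (2 * e)^-1 * `|f x - u x| ^+ 2 - `|f x - u x| =
      (2 * e)^-1 * (`|f x - u x| - e) ^+ 2 by field; rewrite gt_eqF.
    by rewrite mulr_ge0 ?sqr_ge0// invr_ge0 mulr_ge0// ltW.
  have e2 : 0 <= (2 * e)^-1 by rewrite invr_ge0 mulr_ge0// ltW.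
  have e20 : 0 <= e / 2 by rewrite divr_ge0// ltW.
  rewrite ge0_integralD//; last 3 first.
  - exact/measurable_EFinP/measurableT_comp.
  - by move=> x _; rewrite -EFinM -EFinD lee_fin addr_ge0// mulr_ge0// sqr_ge0.
  - by apply: emeasurable_funD => //; exact: measurable_funeM.
  rewrite ge0_integralD//; last 2 first.
  - by move=> x _; rewrite -EFinM lee_fin mulr_ge0// sqr_ge0.
  - exact: measurable_funeM.
  rewrite integral_cst// ge0_integralZl//; last by move=> x _; rewrite lee_fin sqr_ge0.
  have -> : (e / 2 * V' + e)%:E = ((e / 2)%:E * V'%:E + e%:E)%E by [].
  apply: leeD => //; apply: leeD.
    by rewrite lee_wpmul2l ?lee_fin//; exact: VE.
  have -> : e%:E = ((2 * e)^-1%:E * d1%:E)%E.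
    by rewrite -EFinM; congr (_%:E); rewrite /d1; field; rewrite gt_eqF.
  by rewrite lee_wpmul2l// lee_fin.
have step2 : (\int[mu]_(x in O) (h (grad f x) ^+ 2)%:E <=
    ((1 + e) * Y' + e / (c / 2))%:E)%E.
  pose N x := \sum_(i < n.+1) (partial i f x - g x 0 i) ^+ 2.
  have N0 x : 0 <= N x by apply: sumr_ge0 => i _; exact: sqr_ge0.
  have mN : measurable_fun O (fun x => (N x)%:E).
    rewrite (_ : (fun _ => _) = (fun x => \sum_(i < n.+1) ((partial i f x - g x 0 i) ^+ 2)%:E)%E).
      exact: emeasurable_sum.
    by apply/funext => x; rewrite sumEFin.
  have intN : (\int[mu]_(x in O) (N x)%:E <= (n.+1%:R * d2)%:E)%E.
    under eq_integral do rewrite -sumEFin.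
    rewrite ge0_integral_sum//; last by move=> i x _; rewrite lee_fin sqr_ge0.
    apply: (@le_trans _ _ (\sum_(i < n.+1) d2%:E)%E); first exact: lee_sum.
    by rewrite sumEFin lee_fin sumr_const card_ord mulr_natl.
  pose B := (1 + e^-1) * L ^+ 2.
  have B0 : 0 <= B by rewrite mulr_ge0 ?sqr_ge0// addr_ge0// invr_ge0 ltW.
  have e1 : 0 <= 1 + e by rewrite addr_ge0// ltW.
  apply: (@le_trans _ _ (\int[mu]_(x in O)
    ((1 + e)%:E * (h (g x) ^+ 2)%:E + B%:E * (N x)%:E))%E).
    apply: ge0_le_integral => //.
    - by move=> x _; rewrite lee_fin sqr_ge0.
    - by apply: emeasurable_funD; exact: measurable_funeM.
    move=> x _; rewrite -!EFinM -EFinD lee_fin.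
    set p := grad f x; set q := g x.
    have hpq : h p <= h q + h (p - q).
      by have := support_functionD cK K0 q (p - q); rewrite addrC subrK.
    have hN : h (p - q) ^+ 2 <= L ^+ 2 * N x.
      apply: (@le_trans _ _ ((L * `|p - q|) ^+ 2)).
        by rewrite ler_sqr ?nnegrE ?mulr_ge0// ltW.
      rewrite exprMn ler_wpM2l ?sqr_ge0//; apply: le_trans (rV_norm_sqr_le _) _.
      by apply: ler_sum => i _; rewrite !mxE.
    apply: (@le_trans _ _ ((h q + h (p - q)) ^+ 2)).
      by rewrite ler_sqr ?nnegrE ?addr_ge0.
    (* The weighted square keeps the coefficient of the limit energy close to 1 and leaves the large
       factor [1 + e^-1] to the small term. *)
    apply: (@le_trans _ _ ((1 + e) * h q ^+ 2 + (1 + e^-1) * h (p - q) ^+ 2)).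
      rewrite -subr_ge0.
      have -> : (1 + e) * h q ^+ 2 + (1 + e^-1) * h (p - q) ^+ 2 - (h q + h (p - q)) ^+ 2
        = e^-1 * (e * h q - h (p - q)) ^+ 2 by field; rewrite gt_eqF.
      by rewrite mulr_ge0 ?sqr_ge0// invr_ge0 ltW.
    by rewrite lerD2l /B -mulrA ler_wpM2l// addr_ge0// invr_ge0 ltW.
  rewrite ge0_integralD//; last 4 first.
  - by move=> x _; rewrite -EFinM lee_fin mulr_ge0// sqr_ge0.
  - exact: measurable_funeM.
  - by move=> x _; rewrite -EFinM lee_fin mulr_ge0.
  - exact: measurable_funeM.
  rewrite ge0_integralZl//; last by move=> x _; rewrite lee_fin sqr_ge0.
  rewrite ge0_integralZl//; last by move=> x _; rewrite lee_fin.
  have -> : ((1 + e) * Y' + e / (c / 2))%:E =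
      ((1 + e)%:E * Y + B%:E * (n.+1%:R * d2)%:E)%E.
    rewrite -(fineK Yfin) -/Y' -!EFinM -EFinD; congr ((_ + _)%:E).
    have -> : B * (n.+1%:R * d2) = M * d2 by rewrite mulrA.
    by rewrite /d2; field; rewrite !gt_eqF.
  by apply: leeD => //; rewrite lee_wpmul2l// lee_fin.
apply: (le_trans step1).
have step3 := test_function_young K_body symK Omega_body tf c0.
apply: (@le_trans _ _ ((r ^+ 2 / (6 * c))%:E * mu O +
   (c / 2)%:E * ((1 + e) * Y' + e / (c / 2))%:E + (e / 2 * V' + e)%:E)%E).
  apply: leeD => //; apply: (le_trans step3); apply: leeD => //.
  by rewrite lee_wpmul2l// lee_fin ltW.
rewrite -(fineK Yfin) -/Y' -!addeA; apply: leeD => //.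
rewrite -!EFinM -!EFinD lee_fin -eD /D.
have -> : c / 2 * ((1 + e) * Y' + e / (c / 2)) = c / 2 * Y' + e * (c / 2 * Y') + e.
  by field; rewrite gt_eqF.
lra.
Qed.

End sobolev_energy.

(** * Optimisation of Young's parameter and the quotient *)

Lemma sqr_le_of_young {R : realFieldType} (x y B : R) : 0 <= x -> 0 <= y -> 0 <= B ->
  (forall c, 0 < c -> x <= B / (2 * c) + c / 2 * y) -> x ^+ 2 <= B * y.
Proof.
move=> x0 y0 B0 H; have [->|xn] := eqVneq x 0; first by rewrite expr0n mulr_ge0.
have xp : 0 < x by rewrite lt_neqAle eq_sym xn.
have [ye|yn] := eqVneq y 0.
  (* With [y = 0] a large [c] gives a contradiction; this one makes the right-hand side
     [x * B / (2 (B + 1))], less than [x]. *)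
  have c0 : 0 < (B + 1) / x by rewrite divr_gt0// ltr_wpDl.
  have := H _ c0; rewrite ye mulr0 addr0.
  have -> : B / (2 * ((B + 1) / x)) = x * (B / (2 * (B + 1))).
    by field; rewrite xn gt_eqF// ltr_wpDl.
  rewrite ler_pMr// ler_pdivlMr; last by rewrite mulr_gt0// ltr_wpDl.
  by rewrite mul1r; lra.
have yp : 0 < y by rewrite lt_neqAle eq_sym yn.
(* At [c = x / y] the term [c / 2 * y] is [x / 2], and what remains is [x <= B * y / x]. *)
have := H (x / y) (divr_gt0 xp yp).
have -> : B / (2 * (x / y)) + x / y / 2 * y = (B * y / x + x) / 2.
  by field; rewrite xn yn.
rewrite ler_pdivlMr// => h; have : x <= B * y / x by lra.
by rewrite ler_pdivlMr.
Qed.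

(** Infinite energy gives the quotient 0. Zero energy has inverse [+oo], but the quadratic bound
    then forces [I = 0], and [0 * +oo] is 0. *)
Lemma sqre_div_le {R : realType} (I X V Y : \bar R) (s : R) :
  (`|I| <= X)%E -> (0 <= V)%E -> (0 <= Y)%E -> V \is a fin_num ->
  (forall c : R, 0 < c -> (X <= (s ^+ 2 / (6 * c))%:E * V + (c / 2)%:E * Y)%E) ->
  (I ^+ 2 / Y <= (3^-1 * s ^+ 2)%:E * V)%E.
Proof.
move=> IX V0 Y0 Vfin H; have s20 := sqr_ge0 s.
have X0 : (0 <= X)%E by exact: le_trans (abse_ge0 _) IX.
have rhs0 : (0 <= (3^-1 * s ^+ 2)%:E * V)%E.
  by rewrite mule_ge0// lee_fin mulr_ge0// invr_ge0.
have [->|Yoo] := eqVneq Y +oo%E; first by rewrite invey mule0.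
have Yfin : Y \is a fin_num by rewrite ge0_fin_numE// lt_neqAle Yoo leey.
move: V Y Vfin Yfin V0 Y0 H rhs0 {Yoo} => [v| |]// [y| |]// _ _.
rewrite !lee_fin => v0 y0 H rhs0.
have Xfin : X \is a fin_num.
  by rewrite ge0_fin_numE//; apply: le_lt_trans (H 1 ltr01) _; rewrite -!EFinM -EFinD ltey.
have Ifin : I \is a fin_num.
  by rewrite fin_num_abs; apply: le_lt_trans IX _; rewrite -ge0_fin_numE.
move: I X Ifin Xfin IX X0 H => [i| |]// [x| |]// _ _; rewrite abse_EFin !lee_fin => ix x0 H.
have ixy : i ^+ 2 <= (3^-1 * s ^+ 2 * v) * y.
  apply: (@le_trans _ _ (x ^+ 2)).
    by rewrite -(real_normK (num_real i)) ler_sqr ?nnegrE.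
  apply: sqr_le_of_young => // c c0.
  have := H c c0; rewrite -!EFinM -EFinD lee_fin; congr (_ <= _ + _).
  by field; rewrite gt_eqF.
rewrite -EFin_expe -EFinM; have [ye|yn] := eqVneq y 0.
  have /eqP : i ^+ 2 = 0.
    by apply/eqP; rewrite eq_le sqr_ge0 andbT; move: ixy; rewrite ye mulr0.
  by move=> /eqP ->; rewrite mul0e.
by rewrite inver (negbTE yn) -EFinM lee_fin ler_pdivrMr// lt_neqAle eq_sym yn.
Qed.


Theorem theorem4p3 (R : realType) (n : nat) (K Omega : set 'rV[R]_n.+1)
  (K_body : convex_body K) (K_reg : C2plus_regular K)
  (K_sym : origin_symmetric K)
  (Omega_body : convex_body Omega) (Omega_bounded : bounded_set Omega) :
  (torsional_rigidity K Omega / lebesgue_rV n.+1 Omega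
     <= (3^-1 * inradius K Omega ^+ 2)%:E)%E.
Proof.
have cK : compact K by case: K_body.
have K0 : K !=set0 by case: K_body => _ _ [x /interior_subset]; exists x.
have mO : measurable Omega° by apply: open_measurable_rV; exact: open_interior.
have mOmega : measurable Omega.
  by apply: closed_measurable_rV; apply: compact_closed => //; case: Omega_body.
have s20 := sqr_ge0 (inradius K Omega).
have c0 : (0 <= 3^-1 * inradius K Omega ^+ 2) by rewrite mulr_ge0// invr_ge0.
have [Voo|Voo] := eqVneq (lebesgue_rV n.+1 Omega) +oo%E.
  by rewrite Voo invey mule0 lee_fin.
have V0 : (0 <= lebesgue_rV n.+1 Omega)%E by exact: measure_ge0.
have OV : (lebesgue_rV n.+1 Omega° <= lebesgue_rV n.+1 Omega)%E.
  by apply: le_measure; rewrite ?inE//; exact: interior_subset.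
have Vlt : (lebesgue_rV n.+1 Omega < +oo)%E by rewrite lt_neqAle Voo leey.
have Olt : (lebesgue_rV n.+1 Omega° < +oo)%E by exact: le_lt_trans OV _.
have TV : (torsional_rigidity K Omega <=
    (3^-1 * inradius K Omega ^+ 2)%:E * lebesgue_rV n.+1 Omega)%E.
  apply: ge_ereal_sup => _ [u [g [W _ ->]]].
  (* The Sobolev space lives on the interior while the quotient uses the measure of [Omega];
     monotonicity of the measure joins the two. *)
  apply: (@le_trans _ _
    ((3^-1 * inradius K Omega ^+ 2)%:E * lebesgue_rV n.+1 Omega°)%E); last first.
    by rewrite lee_wpmul2l// lee_fin.
  apply: (@sqre_div_le _ _ (\int[lebesgue_rV n.+1]_(x in Omega°) `|u x|%:E)%E) => //.
  - apply: (@le_abse_integral _ _ _ _ _ (EFin \o u)) => //.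
    by apply/measurable_EFinP; apply: L2_measurable => //; case: W => [[]].
  - by apply: integral_ge0 => x _; rewrite lee_fin sqr_ge0.
  - by rewrite ge0_fin_numE.
  - by move=> c c_gt0; exact: sobolev_young.
(* The inverse of 0 is [+oo], so this case is settled by [TV], which makes the rigidity at most
   0. *)
have [VE|Vn0] := eqVneq (lebesgue_rV n.+1 Omega) 0%E.
  rewrite VE inve0; apply: (@le_trans _ _ 0%E); last by rewrite lee_fin.
  by apply: mule_le0_ge0 => //; move: TV; rewrite VE mule0.
have Vfin : lebesgue_rV n.+1 Omega \is a fin_num by rewrite ge0_fin_numE.
rewrite -(fineK Vfin) inver; have vp : 0 < fine (lebesgue_rV n.+1 Omega).
  by rewrite fine_gt0// Vlt andbT lt_neqAle eq_sym Vn0.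
by rewrite gt_eqF// lee_pdivrMr// fineK.
Qed.
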